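(* Consider the system $x_{k+1}=Ax_k+B^Lu_k^L+B^Ru_k^R+w_k$, $k=0,\dots,N$, with the cost functions $J_N^L$, $J_N^R$ and the admissible sets $\mathcal U_N^L,\mathcal U_N^R$ of the context. The open-loop Nash equilibrium $(u_k^{L,*},u_k^{R,*})\in\mathcal U_N^L\times\mathcal U_N^R$ of Problem LRSNG exists and is unique if and only if the following two conditions are satisfied. 1) (Convexity condition) $$\inf_{\delta u^L\in\mathcal U_N^L}\delta J_N^L(\delta u_k^L)\ge 0\quad\text{and}\quad \inf_{\Delta u^R\in\mathcal U_N^R}\Delta J_N^R(\Delta u_k^R)\ge 0 .$$ 2) (Stationary conditions) The equations $$0=S^Lu_k^{L,*}+\mathbb E[(B^L)^T\theta_k^L\mid\mathcal F_k^L],\qquad 0=M^Ru_k^{R,*}+\mathbb E[(B^R)^T\theta_k^R\mid\mathcal F_k^R],\qquad k=0,\dots,N,$$ can be uniquely solved for $(u_k^{L,*},u_k^{R,*})\in\mathcal U_N^L\times\mathcal U_N^R$, where $x_k$ is the state generated by $(u_k^{L,*},u_k^{R,*})$ and the costates satisfy, for $k=0,\dots,N$, $$\theta_{k-1}^L=Q^Lx_k+\mathbb E[A^T\theta_k^L\mid\mathcal F_k^L],\quad \theta_N^L=P_{N+1}^Lx_{N+1},$$ $$\theta_{k-1}^R=Q^Rx_k+\mathbb E[A^T\theta_k^R\mid\mathcal F_k^L],\quad \theta_N^R=P_{N+1}^Rx_{N+1}.$$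
   Context: System: $x_{k+1}=Ax_k+B^Lu_k^L+B^Ru_k^R+w_k$, with $x_k\in\mathbb R^n$, $u_k^L\in\mathbb R^{m_1}$ (local player), $u_k^R\in\mathbb R^{m_2}$ (remote player), and constant matrices $A,B^L,B^R$ of compatible dimensions. The initial state $x_0$ is Gaussian with mean $\mu$ and covariance $\Sigma_{x_0}$; the noises $w_k$ are Gaussian with mean zero and covariance $\Sigma_w$; $x_0,w_0,w_1,\dots$ are mutually independent. $\gamma_k$ are i.i.d. Bernoulli variables with $\mathbb P(\gamma_k=1)=p$, $\mathbb P(\gamma_k=0)=1-p$, independent of $x_0$ and of the noises. Information sets: $\mathcal F_k^R=\sigma\{\gamma_0x_0,\dots,\gamma_kx_k\}$ and $\mathcal F_k^L=\sigma\{x_0,w_0,\dots,w_{k-1},\gamma_0x_0,\dots,\gamma_kx_k\}$. Admissible sets: $\mathcal U_N^L$ is the set of sequences $(u_0^L,\dots,u_N^L)$ with $u_k^L\in\mathbb R^{m_1}$ being $\mathcal F_k^L$-adapted and $\sum_{k=0}^N\mathbb E[(u_k^L)^Tu_k^L]<\infty$; $\mathcal U_N^R$ is the set of sequences $(u_0^R,\dots,u_N^R)$ with $u_k^R\in\mathbb R^{m_2}$ being $\mathcal F_k^R$-adapted and $\sum_{k=0}^N\mathbb E[(u_k^R)^Tu_k^R]<\infty$. Costs (all weighting matrices are given symmetric matrices of compatible dimensions): $$J_N^L(u_k^L,u_k^R)=\sum_{k=0}^N\mathbb E[x_k^TQ^Lx_k+(u_k^L)^TS^Lu_k^L+(u_k^R)^TM^Lu_k^R]+\mathbb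 E[x_{N+1}^TP_{N+1}^Lx_{N+1}],$$ $$J_N^R(u_k^L,u_k^R)=\sum_{k=0}^N\mathbb E[x_k^TQ^Rx_k+(u_k^L)^TS^Ru_k^L+(u_k^R)^TM^Ru_k^R]+\mathbb E[x_{N+1}^TP_{N+1}^Rx_{N+1}].$$ Problem LRSNG: find $u^L\in\mathcal U_N^L$ and $u^R\in\mathcal U_N^R$ to minimize $J_N^L$ and $J_N^R$, respectively. Open-loop Nash equilibrium: a pair $(u_k^{L,*},u_k^{R,*})\in\mathcal U_N^L\times\mathcal U_N^R$ with $J_N^L(u_k^{L,*},u_k^{R,*})\le J_N^L(u_k^L,u_k^{R,*})$ for all $u^L\in\mathcal U_N^L$ and $J_N^R(u_k^{L,*},u_k^{R,*})\le J_N^R(u_k^{L,*},u_k^R)$ for all $u^R\in\mathcal U_N^R$. Second variations: for $\delta u^L\in\mathcal U_N^L$, $$\delta J_N^L(\delta u_k^L)=\sum_{k=0}^N\mathbb E[z_k^TQ^Lz_k+(\delta u_k^L)^TS^L\delta u_k^L]+\mathbb E[z_{N+1}^TP_{N+1}^Lz_{N+1}],\quad z_{k+1}=Az_k+B^L\delta u_k^L,\ z_0=0;$$ for $\Delta u^R\in\mathcal U_N^R$, $$\Delta J_N^R(\Delta u_k^R)=\sum_{k=0}^N\mathbb E[y_k^TQ^Ry_k+(\Delta u_k^R)^TM^R\Delta u_k^R]+\mathbb E[y_{N+1}^TP_{N+1}^Ry_{N+1}],\quad y_{k+1}=Ay_k+B^R\Delta u_k^R,\ y_0=0.$$ (Here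 $z_k$ and $y_k$ are the difference quotients of the state under perturbation of the local control by $\varepsilon\,\delta u^L$, resp. of the remote control by $\eta\,\Delta u^R$.) *)

(* Defs.v *)
From mathcomp Require Import all_boot all_order all_algebra.
From mathcomp Require Import all_classical all_reals all_analysis.

Set Implicit Arguments.
Unset Strict Implicit.
Unset Printing Implicit Defensive.

Import Order.TTheory GRing.Theory Num.Theory.
Import numFieldNormedType.Exports.

Local Open Scope classical_set_scope.
Local Open Scope ring_scope.

Definition quad (R : realType) (m : nat) (M : 'M[R]_m) (x : 'cV[R]_m) : R :=
  (x^T *m M *m x) ord0 ord0.

Definition dotv (R : realType) (m : nat) (a x : 'cV[R]_m) : R :=
  (a^T *m x) ord0 ord0.

(* sigma(X), generated by the coordinates of the vector X; measurability of X
   with respect to a sigma-algebra G is the inclusion of sigma(X) in G. *)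
Definition sigma_vec (T : Type) (R : realType) (m : nat) (X : T -> 'cV[R]_m) :
    set (set T) :=
  g_sigma_preimage (fun (i : 'I_m) (t : T) => X t i ord0).

(* All linear forms of X are normal; the degenerate ones are Dirac masses and
   are treated apart because normal_prob _ 0 is not a Dirac mass. *)
Definition gaussian d (T : measurableType d) (R : realType)
    (P : probability T R) (m : nat) (X : T -> 'cV[R]_m)
    (mean : 'cV[R]_m) (cov : 'M[R]_m) : Prop :=
  [/\ sigma_vec X `<=` measurable,
      cov^T = cov,
      forall a : 'cV[R]_m, 0 <= quad cov a &
      forall (a : 'cV[R]_m) (B : set R), measurable B ->
        P ((fun t => dotv a (X t)) @^-1` B) =
        (if quad cov a == 0 then \d_(dotv a mean) B
         else normal_prob (dotv a mean) (Num.sqrt (quad cov a)) B)].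

Definition mutually_independent d (T : measurableType d) (R : realType)
    (P : probability T R) (I : eqType) (F : I -> set (set T)) : Prop :=
  forall (s : seq I) (E : I -> set T), uniq s ->
    (forall i, i \in s -> F i (E i)) ->
    P (\bigcap_(i in [set` s]) E i) = (\prod_(i <- s) P (E i))%E.

(* Y is a version of E[X | G], coordinatewise. *)
Definition cond_expectation d (T : measurableType d) (R : realType)
    (P : probability T R) (m : nat) (G : set (set T))
    (X Y : T -> 'cV[R]_m) : Prop :=
  sigma_vec Y `<=` G /\
  forall i : 'I_m,
    [/\ P.-integrable setT (fun t => (X t i ord0)%:E),
        P.-integrable setT (fun t => (Y t i ord0)%:E) &
        forall E, G E ->
          (\int[P]_(t in E) (Y t i ord0)%:E =
           \int[P]_(t in E) (X t i ord0)%:E)%E].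

Record plant (R : realType) (n m1 m2 : nat) := Plant {
  pA : 'M[R]_n;
  pBL : 'M[R]_(n, m1);
  pBR : 'M[R]_(n, m2) }.

(* wP weights the terminal state x_{N+1}. *)
Record weights (R : realType) (n m1 m2 : nat) := Weights {
  wQ : 'M[R]_n;
  wS : 'M[R]_m1;
  wM : 'M[R]_m2;
  wP : 'M[R]_n }.

Definition symmetric_weights (R : realType) (n m1 m2 : nat)
    (W : weights R n m1 m2) : Prop :=
  [/\ (wQ W)^T = wQ W, (wS W)^T = wS W, (wM W)^T = wM W & (wP W)^T = wP W].

Record primitives d (T : measurableType d) (R : realType)
    (P : probability T R) (n : nat) := Primitives {
  init : T -> 'cV[R]_n;
  noise : nat -> T -> 'cV[R]_n;
  link : nat -> {RV P >-> bool} }.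

Section Game.
Context d (T : measurableType d) (R : realType) (P : probability T R).
Context (n m1 m2 : nat).
Implicit Types (sys : plant R n m1 m2) (W WL WR : weights R n m1 m2).
Implicit Types (pr : primitives P n) (N : nat).
Implicit Types (x : nat -> T -> 'cV[R]_n).
Implicit Types (uL vL : nat -> T -> 'cV[R]_m1) (uR vR : nat -> T -> 'cV[R]_m2).

(* Indices: x_0, the w_k, the gamma_k. *)
Definition primitive_sigma pr (i : unit + nat + nat) : set (set T) :=
  match i with
  | inl (inl _) => sigma_vec (init pr)
  | inl (inr k) => sigma_vec (noise pr k)
  | inr k => preimage_set_system setT (link pr k) measurable
  end.

Definition standing_assumptions pr (mu : 'cV[R]_n) (Sx0 Sw : 'M[R]_n)
    (p : R) : Prop :=
  [/\ gaussian P (init pr) mu Sx0,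
      forall k, gaussian P (noise pr k) 0 Sw,
      forall k, distribution P (link pr k) =1 bernoulli_prob p &
      mutually_independent P (primitive_sigma pr)].

Fixpoint state sys pr uL uR (k : nat) (t : T) : 'cV[R]_n :=
  match k with
  | 0%N => init pr t
  | k'.+1 => pA sys *m state sys pr uL uR k' t + pBL sys *m uL k' t
             + pBR sys *m uR k' t + noise pr k' t
  end.

Definition observation pr x (k : nat) (t : T) : 'cV[R]_n :=
  (link pr k t)%:R *: x k t.

Definition info_remote pr x (k : nat) : set (set T) :=
  <<s \bigcup_(j in [set j | (j <= k)%N]) sigma_vec (observation pr x j) >>.

Definition info_local pr x (k : nat) : set (set T) :=
  <<s sigma_vec (init pr)
      `|` \bigcup_(j in [set j | (j < k)%N]) sigma_vec (noise pr j)
      `|` \bigcup_(j in [set j | (j <= k)%N]) sigma_vec (observation pr x j) >>.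

Definition admissible (m : nat) N (F : nat -> set (set T)) :
    set (nat -> T -> 'cV[R]_m) :=
  [set u | (forall k, (k <= N)%N -> sigma_vec (u k) `<=` F k) /\
           (\sum_(0 <= k < N.+1) 'E_P[fun t => dotv (u k t) (u k t)] < +oo)%E].

(* The information sets are generated by the state, hence by the controls in
   force. The sets U_N^L and U_N^R are therefore taken at a pair (uL, uR): the
   filtrations are those of the trajectory generated by that pair. When the
   pair is perturbed the filtrations are kept fixed, so that the admissible
   sets are linear spaces, as the second variations require. *)
Definition local_controls sys pr N uL uR : set (nat -> T -> 'cV[R]_m1) :=
  admissible N (info_local pr (state sys pr uL uR)).

Definition remote_controls sys pr N uL uR : set (nat -> T -> 'cV[R]_m2) :=
  admissible N (info_remote pr (state sys pr uL uR)).

Definition admissible_pair sys pr N uL uR : Prop :=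
  local_controls sys pr N uL uR uL /\ remote_controls sys pr N uL uR uR.

Definition cost sys pr N W uL uR : \bar R :=
  let x := state sys pr uL uR in
  (\sum_(0 <= k < N.+1)
     'E_P[fun t => (quad (wQ W) (x k t) + quad (wS W) (uL k t)
                    + quad (wM W) (uR k t))%R]
   + 'E_P[fun t => quad (wP W) (x N.+1 t)])%E.

Definition open_loop_nash sys pr N WL WR uL uR : Prop :=
  [/\ admissible_pair sys pr N uL uR,
      forall vL, local_controls sys pr N uL uR vL ->
        (cost sys pr N WL uL uR <= cost sys pr N WL vL uR)%E &
      forall vR, remote_controls sys pr N uL uR vR ->
        (cost sys pr N WR uL uR <= cost sys pr N WR uL vR)%E].

Fixpoint variation_state (m : nat) (A : 'M[R]_n) (B : 'M[R]_(n, m))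
    (du : nat -> T -> 'cV[R]_m) (k : nat) (t : T) : 'cV[R]_n :=
  match k with
  | 0%N => 0
  | k'.+1 => A *m variation_state A B du k' t + B *m du k' t
  end.

Definition second_variation (m : nat) N (A : 'M[R]_n) (B : 'M[R]_(n, m))
    (Q : 'M[R]_n) (S : 'M[R]_m) (H : 'M[R]_n)
    (du : nat -> T -> 'cV[R]_m) : \bar R :=
  let z := variation_state A B du in
  (\sum_(0 <= k < N.+1)
     'E_P[fun t => (quad Q (z k t) + quad S (du k t))%R]
   + 'E_P[fun t => quad H (z N.+1 t)])%E.

Definition second_variation_local sys N WL
    (du : nat -> T -> 'cV[R]_m1) : \bar R :=
  second_variation N (pA sys) (pBL sys) (wQ WL) (wS WL) (wP WL) du.

Definition second_variation_remote sys N WR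
    (du : nat -> T -> 'cV[R]_m2) : \bar R :=
  second_variation N (pA sys) (pBR sys) (wQ WR) (wM WR) (wP WR) du.

(* Quantified over the pairs at which U_N^L and U_N^R are taken. *)
Definition convexity_condition sys pr N WL WR : Prop :=
  forall uL uR, admissible_pair sys pr N uL uR ->
    (0 <= ereal_inf [set second_variation_local sys N WL du
                    | du in local_controls sys pr N uL uR])%E /\
    (0 <= ereal_inf [set second_variation_remote sys N WR du
                    | du in remote_controls sys pr N uL uR])%E.

(* Shifted index: th k is theta_{k-1}, for 0 <= k <= N+1. *)
Definition costate sys pr N W x (th : nat -> T -> 'cV[R]_n) : Prop :=
  {ae P, forall t, th N.+1 t = wP W *m x N.+1 t} /\
  forall k, (k <= N)%N ->
    exists2 Y : T -> 'cV[R]_n,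
      cond_expectation P (info_local pr x k)
        (fun t => (pA sys)^T *m th k.+1 t) Y &
      {ae P, forall t, th k t = wQ W *m x k t + Y t}.

(* th k.+1 is theta_k, see costate. *)
Definition stationary (m : nat) N (F : nat -> set (set T))
    (B : 'M[R]_(n, m)) (S : 'M[R]_m) (th : nat -> T -> 'cV[R]_n)
    (u : nat -> T -> 'cV[R]_m) : Prop :=
  forall k, (k <= N)%N ->
    exists2 Y : T -> 'cV[R]_m,
      cond_expectation P (F k) (fun t => B^T *m th k.+1 t) Y &
      {ae P, forall t, 0 = S *m u k t + Y t}.

Definition stationary_pair sys pr N WL WR uL uR : Prop :=
  admissible_pair sys pr N uL uR /\
  let x := state sys pr uL uR in
  exists thL thR : nat -> T -> 'cV[R]_n,
    [/\ costate sys pr N WL x thL,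
        costate sys pr N WR x thR,
        stationary N (info_local pr x) (pBL sys) (wS WL) thL uL &
        stationary N (info_remote pr x) (pBR sys) (wM WR) thR uR].

(* Uniqueness is almost sure equality over the horizon 0, ..., N: admissible
   controls can be altered on null events without affecting any cost. *)
Definition exists_unique_pair N
    (C : (nat -> T -> 'cV[R]_m1) -> (nat -> T -> 'cV[R]_m2) -> Prop) : Prop :=
  exists uL uR, C uL uR /\
    forall vL vR, C vL vR -> forall k, (k <= N)%N ->
      {ae P, forall t, vL k t = uL k t} /\ {ae P, forall t, vR k t = uR k t}.

End Game.

(* Main.v *)
(** A perturbation [v] of one player's control changes that player's cost by
    [2 E(l(v)) + E(q(v))] with [l] linear and [q] quadratic, both pathwise.
    Over a linear space of perturbations the control is therefore optimal iff
    [E(l(v)) = 0] and [E(q(v)) >= 0] for all admissible [v].  Since constants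
    are adapted to every filtration, the second condition says that the
    deterministic form [q] is positive, so that convexity at one admissible pair
    is convexity at all of them.  Summation by parts turns [l(v)] into the
    pairing of [v] with [S u + B^T theta], where [theta] is the costate without
    conditioning; by the tower property, vanishing of its expectation amounts to
    the stationarity equation written with the conditioned costate.  Nash pairs
    are thus the stationary pairs of a convex game, and uniqueness transfers. *)

Require Import Defs.
From HB Require Import structures.
From mathcomp Require Import all_boot all_order all_algebra.
From mathcomp Require Import all_classical all_reals all_analysis.
From mathcomp Require Import measurable_realfun ring lra.

Set Implicit Arguments.
Unset Strict Implicit.
Unset Printing Implicit Defensive.

Import Order.TTheory GRing.Theory Num.Theory.
Import numFieldNormedType.Exports.

Local Open Scope classical_set_scope.
Local Open Scope ring_scope.

(** * Integrable and square-integrable functions *)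

Section integrable_spaces.
Context d (T : measurableType d) (R : realType) (P : probability T R).
Implicit Types (f g : T -> R).

Definition L1 f := P.-integrable setT (EFin \o f).
Definition L2 f := measurable_fun setT f /\ L1 (fun t => f t ^+ 2).

Lemma L1_le f g : measurable_fun setT f -> L1 g ->
  (forall t, `|f t| <= g t) -> L1 f.
Proof.
move=> mf ig fg; apply: le_integrable ig => //; first exact/measurable_EFinP.
by move=> t _ /=; rewrite lee_fin (le_trans (fg t)) ?ler_norm.
Qed.

Lemma L1_cst c : L1 (cst c).
Proof. exact: finite_measure_integrable_cst. Qed.

Lemma L1D f g : L1 f -> L1 g -> L1 (fun t => f t + g t).
Proof. by move=> hf hg; exact: (integrableD measurableT hf hg). Qed.

Lemma L1Z c f : L1 f -> L1 (fun t => c * f t).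
Proof. by move=> hf; exact: (integrableZl measurableT c hf). Qed.

Lemma L1_sum (I : eqType) (s : seq I) (F : I -> T -> R) :
  (forall i, i \in s -> L1 (F i)) -> L1 (fun t => \sum_(i <- s) F i t).
Proof.
elim: s => [_|i s ih h].
  by under eq_fun do rewrite big_nil; exact: L1_cst.
under eq_fun do rewrite big_cons.
apply: L1D; first exact/h/mem_head.
by apply: ih => j js; apply: h; rewrite inE js orbT.
Qed.

Lemma L1_sum_fin (I : finType) (F : I -> T -> R) :
  (forall i, L1 (F i)) -> L1 (fun t => \sum_i F i t).
Proof. by move=> h; exact: L1_sum. Qed.

Lemma L2_measurable f : L2 f -> measurable_fun setT f.
Proof. by case. Qed.

Lemma L2M f g : L2 f -> L2 g -> L1 (fun t => f t * g t).
Proof.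
move=> [mf f2] [mg g2]; apply: (@L1_le _ (fun t => f t ^+ 2 + g t ^+ 2)).
- exact: measurable_funM.
- exact: L1D.
- move=> t; rewrite normrM -[f t ^+ 2]real_normK ?num_real//.
  rewrite -[g t ^+ 2]real_normK ?num_real//.
  have := normr_ge0 (f t); have := normr_ge0 (g t); nra.
Qed.

Lemma L2_cst c : L2 (cst c).
Proof. by split; [exact: measurable_cst|exact: (L1_cst (c ^+ 2))]. Qed.

Lemma L2_L1 f : L2 f -> L1 f.
Proof.
move=> h; have := L2M h (L2_cst 1).
by under eq_fun do rewrite mulr1.
Qed.

Lemma L2D f g : L2 f -> L2 g -> L2 (fun t => f t + g t).
Proof.
move=> hf hg; split.
  by apply: measurable_funD; exact: L2_measurable.
under eq_fun do rewrite sqrrD.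
by apply: L1D; [apply: L1D; [exact: hf.2|apply: L1D; exact: L2M]|exact: hg.2].
Qed.

Lemma L2Z c f : L2 f -> L2 (fun t => c * f t).
Proof.
move=> hf; split; first by apply: measurable_funM => //; exact: L2_measurable.
by under eq_fun do rewrite exprMn; apply: L1Z; exact: hf.2.
Qed.

Lemma L2_sum_fin (I : finType) (F : I -> T -> R) :
  (forall i, L2 (F i)) -> L2 (fun t => \sum_i F i t).
Proof.
move=> h; rewrite /index_enum; elim: (Finite.enum I) => [|i s ih].
  by under eq_fun do rewrite big_nil; exact: L2_cst.
by under eq_fun do rewrite big_cons; exact: L2D.
Qed.

Lemma L2_bounded f (M : R) : measurable_fun setT f ->
  (forall t, `|f t| <= M) -> L2 f.
Proof.
move=> mf fM; split => //; apply: (@L1_le _ (cst (M ^+ 2))).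
- exact: measurable_funX.
- exact: L1_cst.
- by move=> t; rewrite normrX lerXn2r ?nnegrE ?(le_trans _ (fM t)).
Qed.

Lemma L2_indic E : measurable E -> L2 (\1_E : T -> R).
Proof.
move=> mE; apply: (@L2_bounded _ 1) => // t.
by rewrite indicE; case: (_ \in _); rewrite ?normr1 ?normr0.
Qed.

Lemma L2_of_sqr f : measurable_fun setT f ->
  (\int[P]_t (f t ^+ 2)%:E < +oo)%E -> L2 f.
Proof.
move=> mf foo; split => //; apply/integrableP; split.
  by apply/measurable_EFinP; exact: measurable_funX.
by under eq_integral do rewrite gee0_abs ?lee_fin ?sqr_ge0//.
Qed.

Local Notation I E f := (\int[P]_(t in E) f t).

Lemma L1S E f : measurable E -> L1 f -> P.-integrable E (EFin \o f).
Proof. by move=> mE; apply: integrableS. Qed.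

Lemma integral_EFin_L1 E f : measurable E -> L1 f ->
  (\int[P]_(t in E) (f t)%:E = (I E f)%:E)%E.
Proof.
move=> mE h; rewrite /Rintegral fineK//; apply: integrable_fin_num => //.
exact: L1S.
Qed.

Lemma expectation_L1 f : L1 f -> ('E_P[f] = (I setT f)%:E)%E.
Proof. by move=> h; rewrite unlock integral_EFin_L1. Qed.

Lemma RintD E f g : measurable E -> L1 f -> L1 g ->
  I E (fun t => f t + g t) = I E f + I E g.
Proof. by move=> mE hf hg; rewrite RintegralD//; exact: L1S. Qed.

Lemma RintZ E c f : measurable E -> L1 f -> I E (fun t => c * f t) = c * I E f.
Proof. by move=> mE hf; rewrite RintegralZl//; exact: L1S. Qed.

Lemma Rint_sum E (J : eqType) (s : seq J) (F : J -> T -> R) : measurable E ->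
  (forall i, i \in s -> L1 (F i)) ->
  I E (fun t => \sum_(i <- s) F i t) = \sum_(i <- s) I E (F i).
Proof.
move=> mE; elim: s => [_|i s ih h].
  by under eq_Rintegral do rewrite big_nil; rewrite big_nil Rintegral_cst// mul0r.
under eq_Rintegral do rewrite big_cons.
rewrite big_cons RintD//; last 2 first.
- exact/h/mem_head.
- by apply: L1_sum => j js; apply: h; rewrite inE js orbT.
by rewrite ih// => j js; apply: h; rewrite inE js orbT.
Qed.

Lemma Rint_indic E f : measurable E -> I E f = I setT (fun t => f t * \1_E t).
Proof.
move=> mE; rewrite Rintegral_mkcond; apply: eq_Rintegral => t _.
by rewrite patchE indicE; case: (_ \in _); rewrite ?mulr1 ?mulr0.
Qed.

Lemma Rint_ae E f g : measurable E -> L1 f -> L1 g ->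
  {ae P, forall t, f t = g t} -> I E f = I E g.
Proof.
move=> mE hf hg fg; congr fine; apply: ae_eq_integral => //.
- by apply: (measurable_int P); exact: L1S.
- by apply: (measurable_int P); exact: L1S.
- by apply: filterS fg => t -> _.
Qed.

End integrable_spaces.

(** * Conditional expectation and orthogonality relative to a sub-sigma-algebra *)

Section sub_sigma_algebra.
Context d (T : measurableType d) (R : realType) (P : probability T R).
Variable C : set (set T).
Hypothesis Cmeas : <<s C >> `<=` measurable.

Local Notation GT := (g_sigma_algebraType C).

Lemma measurable_sub (f : T -> R) :
  measurable_fun setT (f : GT -> R) -> measurable_fun setT f.
Proof.
by move=> mf _ B mB; apply: Cmeas; exact: (mf measurableT B mB).
Qed.

Lemma measurable_id_sub : measurable_fun setT (idfun : T -> GT).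
Proof. by move=> _ B mB; rewrite setTI; exact: Cmeas. Qed.

Let phi_mixin := isMeasurableFun.Build _ _ _ _ _ measurable_id_sub.
Let phi : {mfun T >-> GT} := HB.pack (idfun : T -> GT) phi_mixin.

(* Radon-Nikodym on the coarse space [GT], equipped with the image of [P] under
   the identity. *)
Lemma cond_exp_exists (f : T -> R) : L1 P f ->
  exists g : T -> R, [/\ measurable_fun setT (g : GT -> R),
    L1 P g & forall E, <<s C >> E ->
      (\int[P]_(t in E) (g t)%:E = \int[P]_(t in E) (f t)%:E)%E].
Proof.
move=> hf.
pose m : probability GT R := distribution P phi.
pose nu0 := induced_charge hf.
(* The indefinite integral of [f], restricted to the events of the coarse sigma-algebra;
   integrability of [f] makes it finite. *)
pose nu (A : set GT) : \bar R := nu0 A.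
have nu_0 : nu set0 = 0%E by exact: charge0.
have nu_fin : fin_num_fun nu by move=> A mA; apply: fin_num_measure; exact: Cmeas.
have nu_sig : semi_sigma_additive nu.
  move=> F mF tF mU; apply: (@charge_semi_sigma_additive _ T R nu0).

  - move=> i; exact: Cmeas (mF i).
  - by [].
  - exact: Cmeas mU.
pose nu_mixin := isCharge.Build _ GT R nu nu_0 nu_fin nu_sig.
pose nuC : {charge set GT -> \bar R} := HB.pack nu nu_mixin.
have dom : nuC `<< m.
  apply/null_content_dominatesP => A mA mA0.
  rewrite /nuC/= /nu /nu0 /induced_charge; apply: null_set_integral => //.
  - exact: Cmeas mA.
  - apply: (measurable_int P); exact: (L1S (Cmeas mA) hf).
have hg := Radon_Nikodym_integrable dom.
set g := Radon_Nikodym nuC m in hg.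
have gfin t : g t \is a fin_num by exact: Radon_Nikodym_fin_num.
have mg : measurable_fun setT (g : GT -> \bar R) by exact: measurable_int hg.
have mgT : measurable_fun setT (g : T -> \bar R).
  by move=> _ B mB; apply: Cmeas; exact: mg.
(* Integrability for the image measure is carried back to [P]: the map is the identity, so only the
   sigma-algebra changes. *)
have igT : P.-integrable setT (g : T -> \bar R).
  apply/integrableP; split => //; move/integrableP : hg => [_].
  rewrite /m /distribution ge0_integral_pushforward//.
  exact: measurableT_comp.
exists (fine \o g); split.
- exact: measurableT_comp.
- apply: eq_integrable igT => // t _ /=; by rewrite fineK.
- move=> E GE.
  transitivity (\int[P]_(t in E) g t)%E.
    by apply: eq_integral => t _; rewrite fineK.
  have := Radon_Nikodym_integral dom GE.
  rewrite -/g /nuC/= /nu /nu0 /induced_charge => ->.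
  rewrite /m /distribution integral_pushforward//.
  by apply: integrableS igT => //; exact: Cmeas.
Qed.

Import HBNNSimple.

(** Zero integrals over the events of [<<s C >>] make [g] orthogonal to the simple functions
    measurable for that sigma-algebra. Simple functions increasing to [z] and dominated convergence
    carry this over to [z]. *)
Lemma Rint_orthogonal_ge0 (g z : T -> R) : L2 P g -> L2 P z -> (forall t, 0 <= z t) ->
  measurable_fun setT (z : GT -> R) ->
  (forall E, <<s C >> E -> \int[P]_(t in E) g t = 0) ->
  \int[P]_t (g t * z t) = 0.
Proof.
move=> hg hz z0 mz gE.
have mzE : measurable_fun setT (EFin \o z : GT -> \bar R) by exact/measurable_EFinP.
pose h := nnsfun_approx measurableT mzE.
have hcv t : (fun n => h n t) @ \oo --> z t.
  apply: (@fine_cvg _ _ _ _ (fun n => (h n t)%:E)).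
  by apply: (cvg_nnsfun_approx measurableT mzE) => // x _; rewrite lee_fin.
have hle n t : h n t <= z t.
  rewrite -(cvg_lim (@Rhausdorff R) (hcv t)).
  apply: nondecreasing_cvgn_le; last by apply/cvg_ex; exists (z t).
  by move=> a b ab; exact/lefP/nd_nnsfun_approx.
have mh n : measurable_fun setT (h n : T -> R).
  by apply: measurable_sub; exact: measurable_funP.
(* [h n] is the finite sum of its values times the indicators of its level sets, which are events of
   [<<s C >>]. *)
have h0 n : \int[P]_t (g t * h n t) = 0.
  transitivity (\int[P]_t
      (\sum_(y <- finmap.enum_fset (fset_set (range (h n))))
        y * (g t * \1_(h n @^-1` [set y]) t))).
    apply: eq_Rintegral => t _.
    rewrite [in LHS](fimfunE (h n)) fsbig_finite//= mulr_sumr.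
    by apply: eq_bigr => y _; rewrite mulrCA.
  have mI y : <<s C >> (h n @^-1` [set y]).
    rewrite -[X in <<s _ >> X]setTI.
    have mhn : measurable_fun setT (h n : GT -> R) by exact: measurable_funP.
    exact: (mhn measurableT _ (measurable_set1 y)).
  have L1y y : L1 P (fun t => g t * \1_(h n @^-1` [set y]) t).
    by apply: L2M => //; apply: L2_indic; exact: Cmeas.
  rewrite Rint_sum//; last by move=> y _; exact: L1Z.
  rewrite big1// => y _; rewrite RintZ// -Rint_indic; last exact: Cmeas.
  by rewrite gE ?mulr0.
have gz := L2M hg hz.
have cvI : (\int[P]_t (g t * h n t)%:E)%E @[n --> \oo] -->
    (\int[P]_t (g t * z t)%:E)%E.
  (* The dominating function [|g z|] is integrable as a product of two square-integrable functions,
     and it dominates because [0 <= h n <= z]. *)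
  have [|||||//] := @dominated_convergence _ T R P setT measurableT
    (fun n t => (g t * h n t)%:E) (fun t => (g t * z t)%:E)
    (fun t => (`|g t * z t|)%:E).
  - move=> n; apply/measurable_EFinP.
    by apply: measurable_funM => //; exact: L2_measurable hg.
  - exact: measurable_int gz.
  - apply: aeW => t _; apply: cvg_EFin; first by near=> n.
    by apply: cvgMr; exact: hcv.
  - exact: integrable_abse gz.
  - apply: aeW => t n _ /=; rewrite lee_fin !normrM ler_wpM2l//.
    by rewrite !ger0_norm.
have -> : \int[P]_t (g t * z t) = fine (\int[P]_t (g t * z t)%:E)%E by [].
rewrite -(cvg_lim (@ereal_hausdorff R) cvI).
rewrite [X in limn X](_ : _ = cst 0%E) ?lim_cst//.
apply/funext => n; rewrite integral_EFin_L1// ?h0//.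
apply: (@L1_le _ T R P _ (fun t => `|g t * z t|)).
- by apply: measurable_funM => //; exact: L2_measurable hg.
- exact: integrable_abse gz.
- move=> t; rewrite !normrM ler_wpM2l//.
  by rewrite !ger0_norm.
Unshelve. all: by end_near. Qed.

Lemma L2_norm (z : T -> R) : L2 P z -> L2 P (fun t => `|z t|).
Proof.
move=> [mz iz]; split; first exact: measurableT_comp.
by under eq_fun => t do rewrite real_normK ?num_real//.
Qed.

(** Both [|z|] and [z + |z|] are nonnegative and measurable on the coarse space, so the nonnegative
    case applies to each and [z] is their difference. *)
Lemma Rint_orthogonal (g z : T -> R) : L2 P g -> L2 P z ->
  measurable_fun setT (z : GT -> R) ->
  (forall E, <<s C >> E -> \int[P]_(t in E) g t = 0) ->
  \int[P]_t (g t * z t) = 0.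
Proof.
move=> hg hz mz gE.
have hn := L2_norm hz.
have mn : measurable_fun setT ((fun t => `|z t|) : GT -> R) by exact: measurableT_comp.
have e1 : \int[P]_t (g t * `|z t|) = 0 by apply: Rint_orthogonal_ge0.
have e2 : \int[P]_t (g t * (z t + `|z t|)) = 0.
  apply: Rint_orthogonal_ge0 => //; first exact: L2D.
    by move=> t; rewrite -lerBlDl sub0r -normrN ler_norm.
  exact: measurable_funD.
move: e2; under eq_Rintegral do rewrite mulrDr.
by rewrite RintD ?e1 ?addr0//; exact: L2M.
Qed.

End sub_sigma_algebra.

(** * Second moment of the normal law *)

Section normal_moment.
Context (R : realType).
Local Notation mu := (@lebesgue_measure R).
Import Radon_Nikodym_SigmaFinite.

(* The factor [(x - m) ^+ 2] is absorbed by [y <= expR y] taken at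
   [y = 3 (x - m)^2 / (8 s^2)], which leaves the exponent of deviation [2 s]. *)
Lemma sqr_normal_pdf_le (m s x : R) : s != 0 ->
  x ^+ 2 * normal_pdf m s x <=
  (2 * (8 * s ^+ 2 / 3) * normal_peak s / normal_peak (2 * s)) * normal_pdf m (2 * s) x
  + 2 * m ^+ 2 * normal_pdf m s x.
Proof.
move=> s0; have s20 : 2 * s != 0 by rewrite mulf_neq0.
rewrite !normal_pdfE//.
have p2 := normal_peak_gt0 s20; have p1 := normal_peak_gt0 s0.
have -> : (2 * (8 * s ^+ 2 / 3) * normal_peak s / normal_peak (2 * s)) *
  (normal_peak (2 * s) * normal_fun m (2 * s) x) =
  normal_peak s * (2 * (8 * s ^+ 2 / 3) * normal_fun m (2 * s) x).
  by field; rewrite gt_eqF.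
rewrite mulrCA (mulrCA (2 * m ^+ 2)) -mulrDr ler_pM2l//.
have ss : 0 < s ^+ 2 by rewrite exprn_even_gt0.
set y := 3 * (x - m) ^+ 2 / (8 * s ^+ 2).
have -> : normal_fun m (2 * s) x = expR y * normal_fun m s x.
  rewrite /normal_fun -expRD; congr expR; rewrite /y.
  by rewrite -(mulr_natr (s ^+ 2)) -(mulr_natr ((2 * s) ^+ 2)); field; rewrite s0.
have xy : (x - m) ^+ 2 = 8 * s ^+ 2 / 3 * y by rewrite /y; field.
have ey : y <= expR y by rewrite (le_trans _ (expR_ge1Dx y))// lerDr.
have n0 := normal_fun_ge0 m s x.
have key : x ^+ 2 <= 2 * (8 * s ^+ 2 / 3) * expR y + 2 * m ^+ 2.
  have h : 8 * s ^+ 2 / 3 * y <= 8 * s ^+ 2 / 3 * expR y.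
    by rewrite ler_pM2l// divr_gt0// mulr_gt0.
  rewrite -xy in h.
  (* [x ^+ 2 <= 2 (x - m) ^+ 2 + 2 m ^+ 2] is the nonnegativity of [(x - 2 m) ^+ 2]. *)
  have := sqr_ge0 (x - m - m); rewrite !expr2 in h *; nra.
by rewrite mulrA -mulrDl ler_wpM2r.
Qed.

(** Against Lebesgue measure the integrand becomes [x ^+ 2] times the density, which
    [sqr_normal_pdf_le] bounds by a combination of two integrable normal densities. *)
Lemma normal_prob_sqr_lty (m s : R) : s != 0 ->
  (\int[normal_prob m s]_x (x ^+ 2)%:E < +oo)%E.
Proof.
move=> s0.
have dom := normal_prob_dominates m s.
rewrite -(change_of_variables dom)//; last 2 first.
- by move=> x; rewrite lee_fin sqr_ge0.
- by apply/measurable_EFinP; exact: exprn_measurable.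
have -> : (\int[mu]_x ((x ^+ 2)%:E * f (normal_prob m s) mu x) =
    \int[mu]_x (x ^+ 2 * normal_pdf m s x)%:E)%E.
  apply: ae_eq_integral => //.
  - apply: emeasurable_funM.
      by apply/measurable_EFinP; exact: exprn_measurable.
    exact: measurable_int (f_integrable dom).
  - apply/measurable_EFinP; apply: measurable_funM; first exact: exprn_measurable.
    exact: measurable_normal_pdf.
  - have : ae_eq mu setT (f (normal_prob m s) mu) (EFin \o normal_pdf m s).
      apply: integral_ae_eq => //.
      + exact: f_integrable.
      + by apply/measurable_EFinP; exact: measurable_normal_pdf.
      + by move=> E _ mE; rewrite -f_integral.
    by apply: filterS => x h /h /= ->; rewrite EFinM.
set K := 2 * (8 * s ^+ 2 / 3) * normal_peak s / normal_peak (2 * s).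
have ig : mu.-integrable setT (fun x => (K * normal_pdf m (2 * s) x
    + 2 * m ^+ 2 * normal_pdf m s x)%:E).
  have i1 := integrableZl measurableT K (integrable_normal_pdf m (2 * s)).
  have i2 := integrableZl measurableT (2 * m ^+ 2) (integrable_normal_pdf m s).
  exact: (integrableD measurableT i1 i2).
have xp0 x : 0 <= x ^+ 2 * normal_pdf m s x.
  by rewrite mulr_ge0// ?sqr_ge0// normal_pdf_ge0.
have /integrableP[_] : mu.-integrable setT (fun x => (x ^+ 2 * normal_pdf m s x)%:E).
  apply: le_integrable ig => //.
  - apply/measurable_EFinP; apply: measurable_funM; first exact: exprn_measurable.
    exact: measurable_normal_pdf.
  - move=> x _ /=; rewrite lee_fin ger0_norm//.
    by rewrite (le_trans _ (ler_norm _))// sqr_normal_pdf_le.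
apply: le_lt_trans; rewrite le_eqVlt; apply/orP; left; apply/eqP.
by apply: eq_integral => x _; rewrite /= ger0_norm.
Qed.

End normal_moment.

(** * Variations of a quadratic cost along a trajectory *)

Section bilinear.
Context (R : realType) (m : nat).
Implicit Types (a x y : 'cV[R]_m) (M : 'M[R]_m).

Lemma dotvE a x : dotv a x = \sum_i a i ord0 * x i ord0.
Proof. by rewrite /dotv mxE; apply: eq_bigr => i _; rewrite mxE. Qed.

Lemma dotvC a x : dotv a x = dotv x a.
Proof. by rewrite !dotvE; apply: eq_bigr => i _; rewrite mulrC. Qed.

Lemma dotvDl a b x : dotv (a + b) x = dotv a x + dotv b x.
Proof. by rewrite /dotv linearD/= mulmxDl mxE. Qed.

Lemma dotvDr a x y : dotv a (x + y) = dotv a x + dotv a y.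
Proof. by rewrite /dotv mulmxDr mxE. Qed.

Lemma dotvZr c a x : dotv a (c *: x) = c * dotv a x.
Proof. by rewrite /dotv -scalemxAr mxE. Qed.

Lemma dotv0r a : dotv a 0 = 0.
Proof. by rewrite /dotv mulmx0 mxE. Qed.

Lemma dotvv_ge0 x : 0 <= dotv x x.
Proof. by rewrite dotvE sumr_ge0// => i _; rewrite -expr2 sqr_ge0. Qed.

Lemma dotv_delta i a : dotv a (delta_mx i ord0) = a i ord0.
Proof.
rewrite dotvE (bigD1 i)//= big1 => [|j ji]; rewrite mxE.
  by rewrite !eqxx mulr1 addr0.
by rewrite (negbTE ji) mulr0.
Qed.

Lemma quadE M x : quad M x = dotv x (M *m x).
Proof. by rewrite /quad /dotv mulmxA. Qed.

Lemma quadZ M c x : quad M (c *: x) = c ^+ 2 * quad M x.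
Proof. by rewrite !quadE -scalemxAr dotvZr dotvC dotvZr dotvC mulrA expr2. Qed.

End bilinear.

Lemma dotv_mulmx (R : realType) (m q : nat) (M : 'M[R]_(m, q)) a x :
  dotv a (M *m x) = dotv (M^T *m a) x.
Proof. by rewrite /dotv trmx_mul trmxK mulmxA. Qed.

Lemma quadD (R : realType) (m : nat) (M : 'M[R]_m) x y : M^T = M ->
  quad M (x + y) = quad M x + 2 * dotv (M *m x) y + quad M y.
Proof.
move=> sM; rewrite !quadE mulmxDr !dotvDl !dotvDr [dotv x (M *m y)]dotv_mulmx sM.
rewrite [dotv y (M *m x)]dotvC; ring.
Qed.

Section deterministic.
Context (R : realType) (n m N : nat).
Variables (A : 'M[R]_n) (B : 'M[R]_(n, m)).
Variables (Q : 'M[R]_n) (S : 'M[R]_m) (H : 'M[R]_n).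
Implicit Types (x z th : nat -> 'cV[R]_n) (u v : nat -> 'cV[R]_m).

Fixpoint vstate v k : 'cV[R]_n :=
  if k is k'.+1 then A *m vstate v k' + B *m v k' else 0.

Definition path_cost x u : R :=
  \sum_(0 <= k < N.+1) (quad Q (x k) + quad S (u k)) + quad H (x N.+1).

(** The backward recursion is made structural by counting steps from the horizon: [j] stands for the
    time [N.+1 - j]. *)
Fixpoint adjoint_rev x j : 'cV[R]_n :=
  if j is j'.+1 then Q *m x (N - j')%N + A^T *m adjoint_rev x j' else H *m x N.+1.

(* The costate without conditioning, with the shifted index of [costate]. *)
Definition adjoint x k := adjoint_rev x (N.+1 - k).

Lemma adjoint_end x : adjoint x N.+1 = H *m x N.+1.
Proof. by rewrite /adjoint subnn. Qed.

Lemma adjointS x k : (k <= N)%N ->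
  adjoint x k = Q *m x k + A^T *m adjoint x k.+1.
Proof. by move=> kN; rewrite /adjoint subSn//= subSS subKn. Qed.

(** With symmetric weights, half the derivative of the cost in the control at time [k], the effect
    on later states included; hence the factor 2 in [path_costD]. *)
Definition gradient x u k : 'cV[R]_m := S *m u k + B^T *m adjoint x k.+1.

Definition first_variation x u v : R :=
  \sum_(0 <= k < N.+1) dotv (gradient x u k) (v k).

(** Summation by parts. Each state term is a control term minus an increment of
    [dotv (adjoint x k) (vstate v k)]; the increments telescope, the initial value vanishes with
    [vstate v 0], and the final one is the terminal term. *)
Lemma adjoint_parts x v :
  \sum_(0 <= k < N.+1) dotv (Q *m x k) (vstate v k)
    + dotv (H *m x N.+1) (vstate v N.+1)
  = \sum_(0 <= k < N.+1) dotv (B^T *m adjoint x k.+1) (v k).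
Proof.
have E k : (k <= N)%N -> dotv (Q *m x k) (vstate v k) =
    dotv (B^T *m adjoint x k.+1) (v k) -
    (dotv (adjoint x k.+1) (vstate v k.+1) - dotv (adjoint x k) (vstate v k)).
  move=> kN; rewrite (adjointS _ kN) /= dotvDr !dotvDl !dotv_mulmx; ring.
rewrite (eq_big_nat _ _ (F2 := fun k => dotv (B^T *m adjoint x k.+1) (v k) -
    (dotv (adjoint x k.+1) (vstate v k.+1) - dotv (adjoint x k) (vstate v k)))).
  by rewrite big_split/= sumrN telescope_sumr// adjoint_end dotv0r subr0 addrNK.
by move=> k /andP[_ kN]; rewrite E.
Qed.

(** The second-order expansion is exact because the cost is quadratic. Symmetry merges the cross
    terms in pairs, and [adjoint_parts] moves those of the state onto the control. *)
Lemma path_costD x u v : Q^T = Q -> S^T = S -> H^T = H ->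
  path_cost (fun k => x k + vstate v k) (fun k => u k + v k) =
  path_cost x u + 2 * first_variation x u v + path_cost (vstate v) v.
Proof.
move=> sQ sS sH; rewrite /path_cost /first_variation /gradient quadD//.
have -> : \sum_(0 <= k < N.+1) dotv (S *m u k + B^T *m adjoint x k.+1) (v k) =
    \sum_(0 <= k < N.+1) dotv (S *m u k) (v k)
      + (\sum_(0 <= k < N.+1) dotv (Q *m x k) (vstate v k)
         + dotv (H *m x N.+1) (vstate v N.+1)).
  by rewrite adjoint_parts -big_split; apply: eq_bigr => k _; rewrite dotvDl.
under eq_bigr do rewrite !quadD//.
rewrite !big_split/= -!mulr_sumr; ring.
Qed.

Lemma vstateZ c v k : vstate (fun j => c *: v j) k = c *: vstate v k.
Proof.
elim: k => [|k ih] /=; first by rewrite scaler0.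
by rewrite ih -!scalemxAr scalerDr.
Qed.

Lemma path_costZ c v :
  path_cost (vstate (fun k => c *: v k)) (fun k => c *: v k) =
  c ^+ 2 * path_cost (vstate v) v.
Proof.
rewrite /path_cost mulrDr mulr_sumr vstateZ quadZ; congr (_ + _).
by apply: eq_bigr => k _; rewrite vstateZ !quadZ mulrDr.
Qed.

Lemma first_variationZ x u c v :
  first_variation x u (fun k => c *: v k) = c * first_variation x u v.
Proof.
by rewrite /first_variation mulr_sumr; apply: eq_bigr => k _; rewrite dotvZr.
Qed.

End deterministic.

(** * Integrable and square-integrable random vectors *)

Section vectors.
Context d (T : measurableType d) (R : realType) (P : probability T R).

Definition vL1 m (X : T -> 'cV[R]_m) := forall i, L1 P (fun t => X t i ord0).
Definition vL2 m (X : T -> 'cV[R]_m) := forall i, L2 P (fun t => X t i ord0).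

Lemma vL2_vL1 m (X : T -> 'cV[R]_m) : vL2 X -> vL1 X.
Proof. by move=> h i; exact: L2_L1. Qed.

Lemma vL2D m (X Y : T -> 'cV[R]_m) : vL2 X -> vL2 Y -> vL2 (fun t => X t + Y t).
Proof. by move=> hX hY i; under eq_fun do rewrite mxE; exact: L2D. Qed.

Lemma vL1D m (X Y : T -> 'cV[R]_m) : vL1 X -> vL1 Y -> vL1 (fun t => X t + Y t).
Proof. by move=> hX hY i; under eq_fun do rewrite mxE; exact: L1D. Qed.

Lemma vL2M m q (M : 'M[R]_(m, q)) (X : T -> 'cV[R]_q) :
  vL2 X -> vL2 (fun t => M *m X t).
Proof.
move=> hX i; under eq_fun do rewrite mxE.
by apply: L2_sum_fin => j; exact: L2Z.
Qed.

Lemma vL1M m q (M : 'M[R]_(m, q)) (X : T -> 'cV[R]_q) :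
  vL1 X -> vL1 (fun t => M *m X t).
Proof.
move=> hX i; under eq_fun do rewrite mxE.
by apply: L1_sum_fin => j; exact: L1Z.
Qed.

Lemma vL2Z m c (X : T -> 'cV[R]_m) : vL2 X -> vL2 (fun t => c *: X t).
Proof. by move=> hX i; under eq_fun do rewrite mxE; exact: L2Z. Qed.

Lemma vL2_cst m (a : 'cV[R]_m) : vL2 (cst a).
Proof. by move=> i; exact: L2_cst. Qed.

Lemma L1_dotv m (X Y : T -> 'cV[R]_m) : vL2 X -> vL2 Y ->
  L1 P (fun t => dotv (X t) (Y t)).
Proof.
move=> hX hY; under eq_fun do rewrite dotvE.
by apply: L1_sum_fin => i; exact: L2M.
Qed.

Lemma L1_quad m (M : 'M[R]_m) (X : T -> 'cV[R]_m) : vL2 X ->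
  L1 P (fun t => quad M (X t)).
Proof.
by move=> hX; under eq_fun do rewrite quadE; apply: L1_dotv => //; exact: vL2M.
Qed.

Lemma Rint_mulmx m q (M : 'M[R]_(m, q)) (X : T -> 'cV[R]_q) E i :
  measurable E -> vL1 X -> \int[P]_(t in E) (M *m X t) i ord0 =
  \sum_j M i j * \int[P]_(t in E) X t j ord0.
Proof.
move=> mE hX; under eq_Rintegral do rewrite mxE.
rewrite Rint_sum//; last by move=> j _; exact: L1Z.
by apply: eq_bigr => j _; rewrite RintZ.
Qed.

(** Translates the inclusions in [admissible] and [cond_expectation] into coordinatewise
    measurability on the coarse space, which is stable under algebraic operations. *)
Lemma sigma_vecP (C : set (set T)) m (X : T -> 'cV[R]_m) :
  sigma_vec X `<=` <<s C >> <->
  forall i, measurable_fun setT ((fun t => X t i ord0) : g_sigma_algebraType C -> R).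
Proof.
split=> [h i _ B mB|h].
  apply: h; apply: sub_sigma_algebra.
  by rewrite (bigD1 i)//=; left; exists B.
apply: (@smallest_sub _ (sigma_algebra setT) _ _ (smallest_sigma_algebra _ _)).
apply: (big_ind (fun F => F `<=` <<s C >>)) => [//|F G FC GC|i _ _ [B mB <-]].
  by rewrite subUset; split.
exact: (h i measurableT B mB).
Qed.

Lemma sigma_vec_measurable m (X : T -> 'cV[R]_m) :
  sigma_vec X `<=` measurable <->
  forall i, measurable_fun setT (fun t => X t i ord0).
Proof.
split=> [h i _ B mB|h].
  apply: h; apply: sub_sigma_algebra.
  by rewrite (bigD1 i)//=; left; exists B.
apply: (@smallest_sub _ (sigma_algebra setT) _ _ (sigma_algebra_measurable _)).
apply: (big_ind (fun F => F `<=` measurable)) => [//|F G FC GC|i _ _ [B mB <-]].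
  by rewrite subUset; split.
exact: (h i measurableT B mB).
Qed.

End vectors.

(** Measurability of the information set is asked at the single time [k]: in [state_vL2] that of
    later times is not yet known. The second moment at [k] is one term of a finite sum of
    nonnegative terms. *)
Lemma admissible_vL2_at d (T : measurableType d) (R : realType)
    (P : probability T R) m N (F : nat -> set (set T)) (v : nat -> T -> 'cV[R]_m) k :
  admissible P N F v -> (k <= N)%N -> F k `<=` measurable -> vL2 P (v k).
Proof.
move=> [mv sv] kN Fm.
have mvi : forall i, measurable_fun setT (fun t => v k t i ord0).
  by apply/sigma_vec_measurable; exact: subset_trans (mv k kN) Fm.
have E0 j : (0 <= 'E_P[fun t => dotv (v j t) (v j t)])%E.
  by apply: expectation_ge0 => t; exact: dotvv_ge0.
move=> i; apply: L2_of_sqr => //.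
apply: le_lt_trans sv.
apply: (@le_trans _ _ ('E_P[fun t => dotv (v k t) (v k t)])%E); last first.
  rewrite big_mkord (bigD1 (Ordinal (kN : (k < N.+1)%N)))//= leeDl//.
  exact: sume_ge0.
rewrite unlock; apply: ge0_le_integral => //.
- by move=> t _; rewrite lee_fin sqr_ge0.
- by apply/measurable_EFinP; exact: measurable_funX.
- apply/measurable_EFinP; under eq_fun do rewrite dotvE.
  by apply: measurable_sum => j; exact: measurable_funM.
- move=> t _; rewrite lee_fin dotvE (bigD1 i)//= -expr2 lerDl.
  by rewrite sumr_ge0// => j _; rewrite -expr2 sqr_ge0.
Qed.

(** * The optimization problem of one player *)

Section one_player.
Context d (T : measurableType d) (R : realType) (P : probability T R).
Context (n m N : nat).
Variables (A : 'M[R]_n) (B : 'M[R]_(n, m)).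
Variables (Q : 'M[R]_n) (S : 'M[R]_m) (H : 'M[R]_n).
Variable C : nat -> set (set T).
Hypothesis hC : forall k, (k <= N)%N -> <<s C k >> `<=` measurable.
Implicit Types (u v : nat -> T -> 'cV[R]_m) (x : nat -> T -> 'cV[R]_n).

Local Notation U := (@admissible _ _ _ P m N (fun k => <<s C k >>)).

Lemma L1_big (f : nat -> T -> R) : (forall k, (k <= N)%N -> L1 P (f k)) ->
  L1 P (fun t => \sum_(0 <= k < N.+1) f k t).
Proof. by move=> h; apply: L1_sum => k; rewrite mem_index_iota => /andP[_ /h]. Qed.

(** Gathers a cost made of extended-real expectations into one real integral, so that expansions can
    be made path by path under the integral sign. *)
Lemma sum_expectation (f : nat -> T -> R) (g : T -> R) :
  (forall k, (k <= N)%N -> L1 P (f k)) -> L1 P g ->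
  (\sum_(0 <= k < N.+1) 'E_P[f k] + 'E_P[g] =
   (\int[P]_t (\sum_(0 <= k < N.+1) f k t + g t))%:E)%E.
Proof.
move=> hf hg; rewrite RintD//; last exact: L1_big.
rewrite Rint_sum//; last by move=> k; rewrite mem_index_iota => /andP[_ /hf].
rewrite EFinD -sumEFin expectation_L1//; congr (_ + _)%E.
by apply: eq_big_nat => k /andP[_ kN]; rewrite expectation_L1//; exact: hf.
Qed.

Lemma admissibleP v : U v <->
  forall k, (k <= N)%N -> sigma_vec (v k) `<=` <<s C k >> /\ vL2 P (v k).
Proof.
split=> [Uv k kN|h].
  by split; [exact: Uv.1|exact: admissible_vL2_at Uv kN (hC kN)].
split=> [k /h[]//|].
have hd k : (k <= N)%N -> L1 P (fun t => dotv (v k t) (v k t)).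
  by move=> /h[_ ?]; exact: L1_dotv.
have := sum_expectation hd (L1_cst P 0); rewrite expectation_cst adde0 => ->.
exact: ltry.
Qed.

Lemma admissible_vL2 v k : U v -> (k <= N)%N -> vL2 P (v k).
Proof. by move=> /admissibleP h /h[]. Qed.

Lemma admissible_lin c u v : U u -> U v -> U (fun k t => u k t + c *: v k t).
Proof.
move=> /admissibleP hu /admissibleP hv; apply/admissibleP => k kN.
have [mu u2] := hu k kN; have [mv v2] := hv k kN; split.
  move/sigma_vecP in mu; move/sigma_vecP in mv; apply/sigma_vecP => i.
  under eq_fun do rewrite !mxE.
  by apply: measurable_funD => //; exact: measurable_funM.
by apply: vL2D => //; exact: vL2Z.
Qed.

Lemma admissible_cst (w : nat -> 'cV[R]_m) : U (fun k => cst (w k)).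
Proof.
apply/admissibleP => k kN; split; last exact: vL2_cst.
by apply/sigma_vecP => i; exact: measurable_cst.
Qed.

(** Test perturbations: with [a] a basis vector they isolate one time, one event and one coordinate
    of the gradient. *)
Lemma admissible_indic k0 E (a : 'cV[R]_m) : (k0 <= N)%N -> <<s C k0 >> E ->
  U (fun k t => if k == k0 then \1_E t *: a else 0).
Proof.
move=> k0N CE; apply/admissibleP => k kN; have [->|_] := eqVneq k k0.
  split.
    apply/sigma_vecP => i; under eq_fun do rewrite !mxE.
    by apply: measurable_funM => //; exact: measurable_indic.
  move=> i; under eq_fun do rewrite !mxE mulrC.
  apply: L2Z; apply: L2_indic; exact: (hC k0N CE).
split; last exact: vL2_cst.
by apply/sigma_vecP => i; exact: measurable_cst.
Qed.

Lemma vL2_vstate v k : U v -> (k <= N.+1)%N ->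
  vL2 P (fun t => vstate A B (fun j => v j t) k).
Proof.
move=> Uv; elim: k => [_|k ih kN] /=; first exact: vL2_cst.
apply: vL2D; apply: vL2M; first exact/ih/ltnW.
exact: admissible_vL2.
Qed.

Lemma vL2_adjoint x k : (forall j, (j <= N.+1)%N -> vL2 P (x j)) ->
  vL2 P (fun t => adjoint N A Q H (fun j => x j t) k).
Proof.
move=> hx; rewrite /adjoint; elim: (N.+1 - k)%N => [|j ih] /=.
  by apply: vL2M; exact: hx.
apply: vL2D; apply: vL2M => //.
by apply: hx; rewrite (leq_trans (leq_subr _ _)).
Qed.

Lemma L1_path_cost (x : nat -> T -> 'cV[R]_n) u :
  (forall k, (k <= N.+1)%N -> vL2 P (x k)) ->
  (forall k, (k <= N)%N -> vL2 P (u k)) ->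
  L1 P (fun t => path_cost N Q S H (fun k => x k t) (fun k => u k t)).
Proof.
move=> hx hu; apply: L1D; last by apply: L1_quad; exact: hx.
apply: L1_big => k kN; apply: L1D; apply: L1_quad; last exact: hu.
by apply: hx; rewrite (leq_trans kN).
Qed.

Lemma variation_stateE v k t :
  variation_state A B v k t = vstate A B (fun j => v j t) k.
Proof. by elim: k => //= k ->. Qed.

Definition variation_cost v t : R :=
  path_cost N Q S H (vstate A B (fun j => v j t)) (fun j => v j t).

Lemma L1_variation_cost v : U v -> L1 P (variation_cost v).
Proof.
move=> Uv.
apply: (@L1_path_cost (fun k t => vstate A B (fun j => v j t) k)) => k kN.
  exact: vL2_vstate.
exact: admissible_vL2.
Qed.

Lemma second_variationE v : U v ->
  second_variation P N A B Q S H v = (\int[P]_t variation_cost v t)%:E.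
Proof.
move=> Uv; rewrite /second_variation.
have E k : variation_state A B v k = fun t => vstate A B (fun j => v j t) k.
  by apply/funext => t; exact: variation_stateE.
rewrite E; under eq_bigr do rewrite E.
rewrite sum_expectation//.
- move=> k kN; apply: L1D; apply: L1_quad; last exact: admissible_vL2.
  by apply: vL2_vstate => //; rewrite (leq_trans kN).
- by apply: L1_quad; exact: vL2_vstate.
Qed.

(* Constant controls are adapted to every filtration, so convexity is the
   positivity of a deterministic quadratic form, whatever the filtration. *)
Lemma variation_cost_ge0P :
  (forall v, U v -> 0 <= \int[P]_t variation_cost v t) <->
  (forall w : nat -> 'cV[R]_m, 0 <= path_cost N Q S H (vstate A B w) w).
Proof.
split=> [h w|h v Uv]; last by apply: Rintegral_ge0 => t _; exact: h.
have := h _ (admissible_cst w); rewrite /variation_cost/=.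
by rewrite Rintegral_cst// [X in fine X]probability_setT mulr1.
Qed.

Lemma second_variation_infP :
  (0 <= ereal_inf [set second_variation P N A B Q S H v | v in U])%E <->
  (forall w : nat -> 'cV[R]_m, 0 <= path_cost N Q S H (vstate A B w) w).
Proof.
apply: iff_trans variation_cost_ge0P; split=> [h v Uv|h].
  rewrite -lee_fin -second_variationE//; apply: (le_trans h).
  by apply: ereal_inf_lbound; exists v.
apply: le_ereal_inf_tmp => _ [v Uv <-].
by rewrite second_variationE// lee_fin h.
Qed.

Section stationarity.
Variables (x : nat -> T -> 'cV[R]_n) (u : nat -> T -> 'cV[R]_m).
Hypothesis hx : forall k, (k <= N.+1)%N -> vL2 P (x k).
Hypothesis hu : U u.

Definition random_gradient k t : 'cV[R]_m :=
  gradient N A B Q S H (fun j => x j t) (fun j => u j t) k.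

Definition random_first_variation v t : R :=
  first_variation N A B Q S H (fun j => x j t) (fun j => u j t) (fun j => v j t).

Lemma vL2_random_gradient k : (k <= N)%N -> vL2 P (random_gradient k).
Proof.
move=> kN; apply: vL2D; apply: vL2M; first exact: admissible_vL2.
exact: vL2_adjoint.
Qed.

Lemma L1_random_first_variation v : U v -> L1 P (random_first_variation v).
Proof.
move=> Uv; apply: L1_big => k kN; apply: L1_dotv; first exact: vL2_random_gradient.
exact: admissible_vL2.
Qed.

(** The gradient depends on future states, and adapted perturbations see it only through its
    integrals over the events of the information sets. Indicator perturbations extract these
    integrals; conversely, [Rint_orthogonal] extends their vanishing to all adapted
    square-integrable perturbations. *)
Lemma first_variation_eq0P :
  (forall v, U v -> \int[P]_t random_first_variation v t = 0) <->
  (forall k, (k <= N)%N -> forall E, <<s C k >> E -> forall i,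
     \int[P]_(t in E) random_gradient k t i ord0 = 0).
Proof.
have Iell v : U v -> \int[P]_t random_first_variation v t =
    \sum_(0 <= k < N.+1) \sum_i \int[P]_t (random_gradient k t i ord0 * v k t i ord0).
  move=> Uv; rewrite /random_first_variation /first_variation Rint_sum//; last first.
    move=> k; rewrite mem_index_iota => /andP[_ kN].
    by apply: L1_dotv; [exact: vL2_random_gradient|exact: admissible_vL2].
  apply: eq_big_nat => k /andP[_ kN].
  under eq_Rintegral do rewrite dotvE.
  rewrite Rint_sum// => i _; apply: L2M; first exact: vL2_random_gradient.
  exact: admissible_vL2.
split=> [h k kN E CE i|h v Uv].
  have := h _ (admissible_indic (delta_mx i ord0) kN CE).
  rewrite Iell; last exact: admissible_indic.
  rewrite big_mkord (bigD1 (Ordinal (kN : (k < N.+1)%N)))//=.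
  rewrite eqxx [X in _ + X]big1 ?addr0; last first.
    move=> j jk; have jk' : (j == k :> nat) = false by apply/negbTE.
    rewrite big1// => l _; rewrite jk'.
    under eq_Rintegral do rewrite [X in _ * X]mxE mulr0.
    by rewrite Rintegral_cst// mul0r.
  rewrite (bigD1 i)//= big1 ?addr0.
    move=> h0; rewrite Rint_indic; last exact: (hC kN CE).
    rewrite -[RHS]h0; apply: eq_Rintegral => t _.
    by rewrite [X in _ = _ * X]mxE [X in _ = _ * (_ * X)]mxE !eqxx mulr1.
  move=> j ji; under eq_Rintegral do
    rewrite [X in _ * X]mxE [X in _ * (_ * X)]mxE (negbTE ji) !mulr0.
  by rewrite Rintegral_cst// mul0r.
rewrite Iell// big_nat big1// => k kN; rewrite big1// => i _.
have [mv v2] := (admissibleP v).1 Uv k kN.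
apply: (Rint_orthogonal (hC kN)) => //.
- exact: vL2_random_gradient.
- by move/sigma_vecP : mv; exact.
- by move=> E CE; exact: h.
Qed.

Hypotheses (sQ : Q^T = Q) (sS : S^T = S) (sH : H^T = H).

Local Notation J y v :=
  (\int[P]_t path_cost N Q S H (fun k => y k t) (fun k => v k t)).

Lemma path_cost_perturb v : U v ->
  J (fun k t => x k t + vstate A B (fun j => v j t) k) (fun k t => u k t + v k t) =
  J x u + 2 * \int[P]_t random_first_variation v t + \int[P]_t variation_cost v t.
Proof.
move=> Uv; under eq_Rintegral do rewrite path_costD//.
have i1 : L1 P (fun t => path_cost N Q S H (fun k => x k t) (fun k => u k t)).
  by apply: L1_path_cost => // k kN; exact: admissible_vL2.
have i2 := L1_random_first_variation Uv.
have i3 := L1_variation_cost Uv.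
rewrite RintD//; last exact: (L1D i1 (L1Z 2 i2)).
by rewrite RintD//; [rewrite RintZ|exact: (L1Z 2 i2)].
Qed.

(* Perturbing along [c *: v] makes the cost a parabola in [c], minimal at 0. *)
Lemma minimal_iff :
  (forall v, U v -> J x u <=
    J (fun k t => x k t + vstate A B (fun j => v j t) k) (fun k t => u k t + v k t))
  <-> (forall v, U v -> \int[P]_t random_first_variation v t = 0) /\
      (forall v, U v -> 0 <= \int[P]_t variation_cost v t).
Proof.
split=> [h|[h1 h2] v Uv]; last first.
  by rewrite path_cost_perturb// h1// mulr0 addr0 lerDl h2.
have h' v c : U v -> 0 <= 2 * c * (\int[P]_t random_first_variation v t) +
    c ^+ 2 * \int[P]_t variation_cost v t.
  move=> Uv.
  have Ucv : U (fun k t => c *: v k t).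
    rewrite (_ : (fun k t => c *: v k t) = (fun k t => cst 0 t + c *: v k t)).
      exact: (admissible_lin c (admissible_cst (fun=> 0)) Uv).
    by apply/funext => k; apply/funext => t; rewrite add0r.
  have := h _ Ucv; rewrite path_cost_perturb//.
  under [X in 2 * X]eq_Rintegral do rewrite /random_first_variation first_variationZ.
  under [X in _ + X]eq_Rintegral do rewrite /variation_cost path_costZ.
  rewrite RintZ//; last exact: L1_random_first_variation.
  rewrite RintZ//; last exact: L1_variation_cost.
  by rewrite -addrA lerDl mulrA.
have h2 v : U v -> 0 <= \int[P]_t variation_cost v t.
  (* Adding the inequalities for [c = 1] and [c = - 1] cancels the linear term. *)
  move=> Uv; have := h' v 1 Uv; have := h' v (- 1) Uv; lra.
split=> // v Uv; have a0 := h2 v Uv.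
set b := \int[P]_t random_first_variation v t.
set a := \int[P]_t variation_cost v t in a0 *.
(* The parabola [2 c b + c ^+ 2 a] is lowest at [- b / a]; the denominator [1 + a] also covers
   [a = 0] and still gives a negative value unless [b = 0]. *)
have := h' v (- b / (1 + a)) Uv; rewrite -/a -/b.
have a1 : 0 < 1 + a by lra.
have -> : 2 * (- b / (1 + a)) * b + (- b / (1 + a)) ^+ 2 * a =
    - (b ^+ 2 * ((2 + a) / (1 + a) ^+ 2)) by field; rewrite gt_eqF.
rewrite oppr_ge0 => hb.
have : b ^+ 2 <= 0.
  by rewrite -(@pmulr_lle0 _ ((2 + a) / (1 + a) ^+ 2))// divr_gt0 ?exprn_gt0//; lra.
by move=> hb2; apply/eqP; rewrite -sqrf_eq0 eq_le hb2 sqr_ge0.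
Qed.

(** [c] is the player's cost with the opponent's control frozen, and [r] the opponent's own control
    term, a constant that drops out of the comparison. Only values of [c] at [u] plus a perturbation
    are prescribed. *)
Lemma best_responseP (c : (nat -> T -> 'cV[R]_m) -> \bar R) (r : R) :
  c u = (J x u + r)%:E ->
  (forall v, U v -> c (fun k t => u k t + v k t)%R =
    (J (fun k t => x k t + vstate A B (fun j => v j t) k)
       (fun k t => u k t + v k t) + r)%:E) ->
  (forall v, U v -> (c u <= c v)%E) <->
  (forall v, U v -> \int[P]_t random_first_variation v t = 0) /\
  (forall w : nat -> 'cV[R]_m, 0 <= path_cost N Q S H (vstate A B w) w).
Proof.
move=> cu cuv.
have h1 : (forall v, U v -> (c u <= c v)%E) <-> (forall v, U v -> J x u <=
    J (fun k t => x k t + vstate A B (fun j => v j t) k) (fun k t => u k t + v k t)).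
  split=> h v Uv.
    have := h (fun k t => u k t + v k t); rewrite cu cuv// lee_fin lerD2r; apply.
    rewrite (_ : (fun k t => _) = (fun k t => u k t + 1 *: v k t)).
      exact: admissible_lin.
    by apply/funext => k; apply/funext => t; rewrite scale1r.
  (* Linearity of the admissible set: any competitor [v] is [u] plus the admissible perturbation
     [v - u]. *)
  have Uw : U (fun k t => v k t + (-1) *: u k t) by exact: admissible_lin.
  have := h _ Uw; rewrite -(lerD2r r) -lee_fin -cu -cuv//.
  rewrite (_ : (fun k t => _ + _) = v)//.
  by apply/funext => k; apply/funext => t; rewrite scaleN1r addrC subrK.
apply: (iff_trans h1); apply: (iff_trans minimal_iff).
by split=> -[e /variation_cost_ge0P h]; split.
Qed.

End stationarity.

End one_player.

(** * Costates *)

Section conditional_expectation.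
Context d (T : measurableType d) (R : realType) (P : probability T R).

Lemma cond_expectation_exists m (C : set (set T)) (X : T -> 'cV[R]_m) :
  <<s C >> `<=` measurable -> vL1 P X ->
  exists Y, cond_expectation P <<s C >> X Y.
Proof.
move=> hC hX; have [g hg] := choice (fun i => cond_exp_exists hC (hX i)).
exists (fun t => \col_i g i t); split.
  apply/sigma_vecP => i; have [mg _ _] := hg i.
  by under eq_fun do rewrite mxE.
move=> i; have [_ ig eg] := hg i; split; first exact: hX.
  by under eq_fun do rewrite mxE.
by move=> E /eg <-; apply: eq_integral => t _; rewrite mxE.
Qed.

Lemma cond_expectation_Rint m (G : set (set T)) (X Y : T -> 'cV[R]_m) :
  cond_expectation P G X Y -> [/\ vL1 P X, vL1 P Y & forall E i, G E ->
    \int[P]_(t in E) Y t i ord0 = \int[P]_(t in E) X t i ord0].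
Proof.
move=> [_ h]; split=> [i|i|E i GE]; have [hX hY e] := h i => //.
by congr fine; exact: e.
Qed.

Lemma Rint_mulmx_eq m q (M : 'M[R]_(m, q)) (X Y : T -> 'cV[R]_q) E :
  measurable E -> vL1 P X -> vL1 P Y ->
  (forall i, \int[P]_(t in E) X t i ord0 = \int[P]_(t in E) Y t i ord0) ->
  forall i, \int[P]_(t in E) (M *m X t) i ord0 =
            \int[P]_(t in E) (M *m Y t) i ord0.
Proof.
by move=> mE hX hY e i; rewrite !Rint_mulmx//; apply: eq_bigr => j _; rewrite e.
Qed.

Lemma Rint_vec_ae m (X Y : T -> 'cV[R]_m) E : measurable E -> vL1 P X -> vL1 P Y ->
  {ae P, forall t, X t = Y t} ->
  forall i, \int[P]_(t in E) X t i ord0 = \int[P]_(t in E) Y t i ord0.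
Proof. by move=> mE hX hY e i; apply: Rint_ae => //; apply: filterS e => t ->. Qed.

End conditional_expectation.

Section costates.
Context d (T : measurableType d) (R : realType) (P : probability T R).
Context (n m1 m2 N : nat).
Variables (sys : plant R n m1 m2) (pr : primitives P n) (W : weights R n m1 m2).
Variable x : nat -> T -> 'cV[R]_n.
Hypothesis hx : forall k, (k <= N.+1)%N -> vL2 P (x k).
Hypothesis hG : forall k, (k <= N)%N -> info_local pr x k `<=` measurable.

Lemma info_local_mono k l : (k <= l)%N -> info_local pr x k `<=` info_local pr x l.
Proof.
move=> kl; apply: sub_sigma_algebra2; apply: setUSS; first apply: setUSS => //.
  by apply: bigcup_subset => j /= jk; exact: leq_trans jk kl.
by apply: bigcup_subset => j /= jk; exact: leq_trans jk kl.
Qed.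

Lemma info_remote_local k : info_remote pr x k `<=` info_local pr x k.
Proof. by apply: sub_sigma_algebra2; exact: subsetUr. Qed.

Let random_adjoint k t := adjoint N (pA sys) (wQ W) (wP W) (fun j => x j t) k.

Let vL2_random_adjoint k : vL2 P (random_adjoint k).
Proof. exact: vL2_adjoint. Qed.

(* By the tower property the costate and the unconditioned adjoint have the
   same integral over every event of the information set. *)
Lemma costate_mean th : costate sys pr N W x th -> forall k, (k <= N.+1)%N ->
  exists th' : T -> 'cV[R]_n, [/\ vL1 P th', {ae P, forall t, th k t = th' t} &
    forall E, measurable E -> ((k <= N)%N -> info_local pr x k E) ->
      forall i, \int[P]_(t in E) th' t i ord0 =
        \int[P]_(t in E) random_adjoint k t i ord0].
Proof.
(* Backward induction, [j] being the distance from [k] to [N.+1]. *)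
move=> [thN thk] k kN; rewrite -(subKn kN); elim: (N.+1 - k)%N => [|j ih].
  rewrite subn0; exists (fun t => wP W *m x N.+1 t); split => //.
    by apply/vL2_vL1/vL2M; exact: hx.
  by move=> E _ _ i; apply: eq_Rintegral => t _; rewrite /random_adjoint adjoint_end.
(* Past the initial time, truncated subtraction makes both indices 0 and the induction hypothesis is
   the claim itself. *)
have [jN|Nj] := leqP j N; last first.
  have e1 : (N.+1 - j = 0)%N by apply/eqP; rewrite subn_eq0.
  have e2 : (N.+1 - j.+1 = 0)%N by apply/eqP; rewrite subn_eq0 ltnW.
  by rewrite e2; rewrite e1 in ih.
rewrite subSS; move: ih; rewrite subSn// => -[th' [i1 e1 I1]].
have [Y cY eY] := thk _ (leq_subr j N).
have [iX iY IY] := cond_expectation_Rint cY.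
(* The costate equation fixes [th k] only up to a null event, which may leave [th k] non-measurable;
   its right-hand side is an integrable version. *)
exists (fun t => wQ W *m x (N - j)%N t + Y t); split => //.
  by apply: vL1D => //; apply/vL2_vL1/vL2M/hx; rewrite (leq_trans (leq_subr _ _)).
move=> E mE /(_ (leq_subr j N)) GE i.
have iQ : vL1 P (fun t => wQ W *m x (N - j)%N t).
  by apply/vL2_vL1/vL2M/hx; rewrite (leq_trans (leq_subr _ _)).
have iA := vL2_vL1 (vL2_random_adjoint (N - j).+1).
transitivity (\int[P]_(t in E) (wQ W *m x (N - j)%N t) i ord0 +
    \int[P]_(t in E) ((pA sys)^T *m random_adjoint (N - j).+1 t) i ord0); last first.
  rewrite -RintD//; last exact: (vL1M _ iA).
  apply: eq_Rintegral => t _.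
  by rewrite /random_adjoint [in RHS]adjointS ?leq_subr// [RHS]mxE.
under eq_Rintegral do rewrite mxE.
rewrite RintD//; congr (_ + _).
rewrite IY//.
rewrite (@Rint_vec_ae _ _ _ _ _ _ (fun t => (pA sys)^T *m th' t))//; last 2 first.
- exact: vL1M.
- by apply: filterS e1 => t ->.
apply: Rint_mulmx_eq => // l; apply: I1 => // _.
(* The tower property enters here: an event known at one time is still known at the next, where the
   induction hypothesis speaks. *)
exact: (info_local_mono (leqnSn _) GE).
Qed.

(** The backward equations are solved by choosing one version of the conditional expectation per
    step. Integrability is propagated alongside, since each step conditions on the previous
    result. *)
Lemma costate_exists : exists th, costate sys pr N W x th /\
  forall k, (k <= N.+1)%N -> vL1 P (th k).
Proof.
(* [choice] needs a total relation, so the vector itself serves as default value beyond the horizon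
   or without integrability. *)
have ex (kX : nat * (T -> 'cV[R]_n)) : exists Y, (kX.1 <= N)%N -> vL1 P kX.2 ->
    cond_expectation P (info_local pr x kX.1) kX.2 Y.
  have [kN|_] := leqP kX.1 N; last by exists kX.2.
  have [hX|nX] := pselect (vL1 P kX.2); last by exists kX.2.
  by have [Y cY] := cond_expectation_exists (hG kN) hX; exists Y.
have [ce hce] := choice ex.
pose rev := fix rev j : T -> 'cV[R]_n := match j with
  | 0%N => fun t => wP W *m x N.+1 t
  | j'.+1 => fun t => wQ W *m x (N - j')%N t
                      + ce ((N - j')%N, fun t => (pA sys)^T *m rev j' t) t
  end.
have irev j : (j <= N.+1)%N -> vL1 P (rev j).
  elim: j => [_|j ih jN] /=; first by apply/vL2_vL1/vL2M; exact: hx.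
  apply: vL1D.
    by apply/vL2_vL1/vL2M/hx; rewrite (leq_trans (leq_subr _ _)).
  have := hce ((N - j)%N, fun t => (pA sys)^T *m rev j t) (leq_subr _ _).
  by move=> /(_ (vL1M _ (ih (ltnW jN)))) /cond_expectation_Rint[].
exists (fun k => rev (N.+1 - k)%N); split; last first.
  by move=> k kN; apply: irev; exact: leq_subr.
split; first by apply: aeW => t; rewrite subnn.
move=> k kN; rewrite subSS.
exists (ce (k, fun t => (pA sys)^T *m rev (N - k)%N t)).
  apply: (hce (k, _)) => //=; apply: vL1M; apply: irev.
  by rewrite (leq_trans (leq_subr _ _)).
by apply: aeW => t; rewrite subSn//= subKn.
Qed.

Section stationary.
Context (m : nat).
Variables (B : 'M[R]_(n, m)) (S : 'M[R]_m).
Variable C : nat -> set (set T).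
Hypothesis hC : forall k, (k <= N)%N -> <<s C k >> `<=` info_local pr x k.
Variable u : nat -> T -> 'cV[R]_m.
Hypothesis hu : @admissible _ _ _ P m N (fun k => <<s C k >>) u.

Let hCm k : (k <= N)%N -> <<s C k >> `<=` measurable.
Proof. by move=> kN; exact: subset_trans (hC kN) (hG kN). Qed.

Local Notation grad := (random_gradient N (pA sys) B (wQ W) S (wP W) x u).

(** An event of [<<s C k >>] is a local event at time [k], hence at [k.+1], where [costate_mean]
    allows the costate to replace the adjoint. Taking [C] coarser than the local information covers
    the remote player, whose costate is conditioned on local information as well. *)
Let Rint_grad th k E i : costate sys pr N W x th -> (k <= N)%N -> <<s C k >> E ->
  vL1 P (fun t => B^T *m th k.+1 t) ->
  \int[P]_(t in E) grad k t i ord0 = \int[P]_(t in E) (S *m u k t) i ord0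
    + \int[P]_(t in E) (B^T *m th k.+1 t) i ord0.
Proof.
move=> cth kN CE iB; have mE := hCm kN CE.
have [th' [i1 e1 I1]] := costate_mean cth (kN : (k.+1 <= N.+1)%N).
have iA := vL2_vL1 (vL2_random_adjoint k.+1).
have iS : vL1 P (fun t => S *m u k t).
  by apply/vL2_vL1/vL2M; exact: (admissible_vL2 hCm hu kN).
transitivity (\int[P]_(t in E) (S *m u k t) i ord0 +
    \int[P]_(t in E) (B^T *m random_adjoint k.+1 t) i ord0).
  rewrite -RintD//; last exact: (vL1M _ iA).
  by apply: eq_Rintegral => t _; rewrite [LHS]mxE.
congr (_ + _).
rewrite [RHS](@Rint_vec_ae _ _ _ _ _ _ (fun t => B^T *m th' t))//; last 2 first.
- exact: vL1M.
- by apply: filterS e1 => t ->.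
apply: Rint_mulmx_eq => // l; rewrite I1// => _.
exact: (info_local_mono (leqnSn _) (hC kN CE)).
Qed.

Lemma stationary_grad th : costate sys pr N W x th ->
  stationary P N (fun k => <<s C k >>) B S th u ->
  forall k, (k <= N)%N -> forall E, <<s C k >> E -> forall i,
     \int[P]_(t in E) grad k t i ord0 = 0.
Proof.
move=> cth st k kN E CE i; have [Y cY eY] := st k kN.
have [iB iY IY] := cond_expectation_Rint cY.
have mE := hCm kN CE.
have iS : vL1 P (fun t => S *m u k t).
  by apply/vL2_vL1/vL2M; exact: (admissible_vL2 hCm hu kN).
rewrite (Rint_grad i cth kN CE iB) -IY// -RintD//.
rewrite (Rint_ae (g := cst 0))//; last 3 first.
- by apply: L1D; [exact: iS|exact: iY].
- exact: L1_cst.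
- by apply: filterS eY => t /(congr1 (fun a : 'cV[R]_m => a i ord0)); rewrite !mxE.
by rewrite Rintegral_cst// mul0r.
Qed.

(** The required version of the conditional expectation is [- S u]: it is adapted because [u] is,
    and vanishing integrals of the gradient say that it has the right integrals. *)
Lemma grad_stationary th : costate sys pr N W x th ->
  (forall k, (k <= N.+1)%N -> vL1 P (th k)) ->
  (forall k, (k <= N)%N -> forall E, <<s C k >> E -> forall i,
     \int[P]_(t in E) grad k t i ord0 = 0) ->
  stationary P N (fun k => <<s C k >>) B S th u.
Proof.
move=> cth ith g0 k kN.
have [mu2 u2] := (admissibleP P hCm u).1 hu k kN.
have iB : vL1 P (fun t => B^T *m th k.+1 t) by apply: vL1M; exact: ith.
have iS : vL1 P (fun t => S *m u k t) by apply/vL2_vL1/vL2M.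
exists (fun t => - (S *m u k t)); last by apply: aeW => t; rewrite subrr.
split.
  move/sigma_vecP in mu2; apply/sigma_vecP => i.
  under eq_fun do rewrite !mxE.
  apply: measurableT_comp => //; apply: measurable_sum => j.
  by apply: measurable_funM.
have iN i : L1 P (fun t => (- (S *m u k t)) i ord0).
  under eq_fun do rewrite mxE -mulN1r.
  by apply: L1Z; exact: iS.
move=> i; split; [exact: iB|exact: iN|move=> E CE].
have mE := hCm kN CE.
rewrite !integral_EFin_L1//.
have := Rint_grad i cth kN CE iB; rewrite g0// => e; congr EFin.
under eq_Rintegral do rewrite mxE -mulN1r.
rewrite RintZ//.
by rewrite mulN1r; apply/eqP; rewrite eq_sym -addr_eq0 addrC -e.
Qed.

End stationary.

End costates.

(** A coordinate is the linear form of a basis vector, so its law is a Dirac mass or a normal law;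
    both have a finite second moment. *)
Lemma gaussian_vL2 d (T : measurableType d) (R : realType) (P : probability T R)
    m (X : T -> 'cV[R]_m) mean cov :
  gaussian P X mean cov -> vL2 P X.
Proof.
move=> [mX _ cov0 law] i.
have mXi := (sigma_vec_measurable X).1 mX i.
have mXiR : measurable_fun setT ((fun t => X t i ord0) : T -> measurableTypeR R).
  exact: mXi.
apply: L2_of_sqr => //; have {law} := law (delta_mx i ord0).
set q := quad cov _; set a := dotv _ mean => law.
have XiE B : (fun t => dotv (delta_mx i ord0) (X t)) @^-1` B =
    (fun t => X t i ord0) @^-1` B.
  by apply/seteqP; split=> t /=; rewrite dotvC dotv_delta.
have msq : measurable_fun setT (fun y : measurableTypeR R => (y ^+ 2)%:E).
  by apply/measurable_EFinP; exact: exprn_measurable.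
rewrite -[ltLHS](@ge0_integral_pushforward _ _ _ _ _ _ mXiR P setT
  (fun y : measurableTypeR R => (y ^+ 2)%:E))//; last by move=> y _; rewrite lee_fin sqr_ge0.
have [q0|q0] := eqVneq q 0.
  rewrite (eq_measure_integral (@dirac _ (measurableTypeR R) a R)); last first.
    by move=> B mB _; rewrite /= /pushforward -XiE law// q0 eqxx.
  by rewrite integral_dirac// diracT mul1e ltry.
rewrite (eq_measure_integral (normal_prob a (Num.sqrt q))); last first.
  by move=> B mB _; rewrite /= /pushforward -XiE law// (negbTE q0).
by apply: normal_prob_sqr_lty; rewrite sqrtr_eq0 -ltNge lt_neqAle eq_sym q0 cov0.
Qed.

(** * Nash equilibria *)

Section game.
Context d (T : measurableType d) (R : realType) (P : probability T R).
Context (n m1 m2 N : nat).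
Variables (sys : plant R n m1 m2) (WL WR : weights R n m1 m2).
Variable pr : primitives P n.
Hypothesis hWL : symmetric_weights WL.
Hypothesis hWR : symmetric_weights WR.
Hypothesis init2 : vL2 P (init pr).
Hypothesis noise2 : forall k, vL2 P (noise pr k).

(** Naming the generators presents the information sets in the form [<<s C k >>] of the one-player
    results. *)
Definition remote_generators (x : nat -> T -> 'cV[R]_n) k : set (set T) :=
  \bigcup_(j in [set j | (j <= k)%N]) sigma_vec (observation pr x j).

Definition local_generators (x : nat -> T -> 'cV[R]_n) k : set (set T) :=
  sigma_vec (init pr)
  `|` \bigcup_(j in [set j | (j < k)%N]) sigma_vec (noise pr j)
  `|` \bigcup_(j in [set j | (j <= k)%N]) sigma_vec (observation pr x j).

Lemma vL2_sigma_vec m (X : T -> 'cV[R]_m) : vL2 P X -> sigma_vec X `<=` measurable.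
Proof. by move=> h; apply/sigma_vec_measurable => i; exact: L2_measurable. Qed.

Lemma observation_measurable (x : nat -> T -> 'cV[R]_n) k :
  vL2 P (x k) -> sigma_vec (observation pr x k) `<=` measurable.
Proof.
move=> xk; apply/sigma_vec_measurable => i.
under eq_fun do rewrite mxE.
apply: measurable_funM; last exact: L2_measurable.
apply: (@measurableT_comp _ _ _ _ _ _ (fun b : bool => b%:R : R)) => //.
Qed.

Lemma info_local_measurable (x : nat -> T -> 'cV[R]_n) k :
  (forall j, (j <= k)%N -> vL2 P (x j)) -> info_local pr x k `<=` measurable.
Proof.
move=> hx; apply: (@smallest_sub _ (sigma_algebra setT)).
  exact: sigma_algebra_measurable.
rewrite !subUset; split; first split.
- exact: vL2_sigma_vec.
- by move=> E [j _]; exact: vL2_sigma_vec.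
- by move=> E [j /= jk]; apply: observation_measurable; exact: hx.
Qed.

(** States and information sets depend on each other: square-integrable states up to [k] make the
    information at [k] measurable, hence the controls at [k] square integrable, hence the next
    state. The induction therefore carries all earlier times. *)
Lemma state_vL2 uL uR : admissible_pair sys pr N uL uR ->
  forall k, (k <= N.+1)%N -> vL2 P (state sys pr uL uR k).
Proof.
move=> [UL UR]; suff h k : (k <= N.+1)%N ->
    forall j, (j <= k)%N -> vL2 P (state sys pr uL uR j).
  by move=> k kN; exact: h kN k (leqnn k).
elim: k => [_ j|k ih kN j]; first by rewrite leqn0 => /eqP ->.
rewrite leq_eqVlt => /predU1P[->|]; last exact: ih (ltnW kN) j.
have hk := ih (ltnW kN).
have mG := info_local_measurable hk.
have uLk : vL2 P (uL k) by exact: admissible_vL2_at UL kN mG.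
have uRk : vL2 P (uR k).
  apply: (admissible_vL2_at UR kN); apply: subset_trans mG.
  exact: info_remote_local.
apply: vL2D => //; apply: vL2D; last exact: vL2M.
apply: vL2D; last exact: vL2M.
by apply: vL2M; exact: hk.
Qed.

Lemma state_perturb_local uL uR (v : nat -> T -> 'cV[R]_m1) k t :
  state sys pr (fun k t => uL k t + v k t) uR k t =
  state sys pr uL uR k t + vstate (pA sys) (pBL sys) (fun j => v j t) k.
Proof.
elim: k => [|k ih] /=; first by rewrite addr0.
by rewrite ih !mulmxDr [X in X + _ + _]addrACA [X in X + _]addrAC [LHS]addrAC.
Qed.

Lemma state_perturb_remote uL uR (v : nat -> T -> 'cV[R]_m2) k t :
  state sys pr uL (fun k t => uR k t + v k t) k t =
  state sys pr uL uR k t + vstate (pA sys) (pBR sys) (fun j => v j t) k.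
Proof.
elim: k => [|k ih] /=; first by rewrite addr0.
by rewrite ih !mulmxDr [X in X + _ + _]addrAC [X in X + _]addrACA [LHS]addrAC.
Qed.

(** Separates what the local control influences from the remote control term. The trajectory is a
    variable [x] so that a perturbed one can be supplied as a sum. *)
Lemma cost_local W uL uR x : x = state sys pr uL uR ->
  (forall k, (k <= N.+1)%N -> vL2 P (x k)) ->
  (forall k, (k <= N)%N -> vL2 P (uL k)) ->
  (forall k, (k <= N)%N -> vL2 P (uR k)) ->
  cost sys pr N W uL uR = (\int[P]_t path_cost N (wQ W) (wS W) (wP W)
    (fun k => x k t) (fun k => uL k t) +
    \int[P]_t \sum_(0 <= k < N.+1) quad (wM W) (uR k t))%:E.
Proof.
move=> xE hx hL hR; rewrite /cost -xE.
have hxN k : (k <= N)%N -> vL2 P (x k) by move=> kN; apply: hx; exact: ltnW.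
rewrite sum_expectation; last 2 first.
- move=> k kN; apply: L1D; last exact/L1_quad/hR.
  by apply: L1D; apply: L1_quad; [exact: hxN|exact: hL].
- by apply: L1_quad; exact: hx.
rewrite -RintD//; last 2 first.
- exact: L1_path_cost.
- by apply: L1_big => k kN; exact/L1_quad/hR.
congr EFin; apply: eq_Rintegral => t _.
by rewrite /path_cost big_split/= addrAC.
Qed.

Lemma cost_remote W uL uR x : x = state sys pr uL uR ->
  (forall k, (k <= N.+1)%N -> vL2 P (x k)) ->
  (forall k, (k <= N)%N -> vL2 P (uL k)) ->
  (forall k, (k <= N)%N -> vL2 P (uR k)) ->
  cost sys pr N W uL uR = (\int[P]_t path_cost N (wQ W) (wM W) (wP W)
    (fun k => x k t) (fun k => uR k t) +
    \int[P]_t \sum_(0 <= k < N.+1) quad (wS W) (uL k t))%:E.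
Proof.
move=> xE hx hL hR; rewrite /cost -xE.
have hxN k : (k <= N)%N -> vL2 P (x k) by move=> kN; apply: hx; exact: ltnW.
rewrite sum_expectation; last 2 first.
- move=> k kN; apply: L1D; last exact/L1_quad/hR.
  by apply: L1D; apply: L1_quad; [exact: hxN|exact: hL].
- by apply: L1_quad; exact: hx.
rewrite -RintD//; last 2 first.
- exact: L1_path_cost.
- by apply: L1_big => k kN; exact/L1_quad/hL.
congr EFin; apply: eq_Rintegral => t _.
rewrite /path_cost addrAC -big_split/=; congr (_ + _).
by apply: eq_bigr => k _; rewrite addrAC.
Qed.

Definition psd_local := forall w : nat -> 'cV[R]_m1,
  0 <= path_cost N (wQ WL) (wS WL) (wP WL) (vstate (pA sys) (pBL sys) w) w.

Definition psd_remote := forall w : nat -> 'cV[R]_m2,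
  0 <= path_cost N (wQ WR) (wM WR) (wP WR) (vstate (pA sys) (pBR sys) w) w.

Section at_pair.
Variables (uL : nat -> T -> 'cV[R]_m1) (uR : nat -> T -> 'cV[R]_m2).
Hypothesis adm : admissible_pair sys pr N uL uR.

Let x := state sys pr uL uR.
Let hx k : (k <= N.+1)%N -> vL2 P (x k).
Proof. exact: state_vL2. Qed.

Let hG k : (k <= N)%N -> info_local pr x k `<=` measurable.
Proof.
move=> kN; apply: info_local_measurable => j jk; apply: hx.
by rewrite (leq_trans jk)// ltnW.
Qed.

Let hL k : (k <= N)%N -> <<s local_generators x k >> `<=` measurable := @hG k.

Let hR k : (k <= N)%N -> <<s remote_generators x k >> `<=` measurable.
Proof. by move=> kN; apply: subset_trans (hG kN); exact: info_remote_local. Qed.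

Let uLk k : (k <= N)%N -> vL2 P (uL k).
Proof. exact: (admissible_vL2 hL adm.1). Qed.

Let uRk k : (k <= N)%N -> vL2 P (uR k).
Proof. exact: (admissible_vL2 hR adm.2). Qed.

Local Notation UL := (local_controls sys pr N uL uR).
Local Notation UR := (remote_controls sys pr N uL uR).

Definition critical_local := forall v, UL v ->
  \int[P]_t random_first_variation N
    (pA sys) (pBL sys) (wQ WL) (wS WL) (wP WL) x uL v t = 0.

Definition critical_remote := forall v, UR v ->
  \int[P]_t random_first_variation N
    (pA sys) (pBR sys) (wQ WR) (wM WR) (wP WR) x uR v t = 0.

Lemma best_response_local :
  (forall v, UL v -> (cost sys pr N WL uL uR <= cost sys pr N WL v uR)%E) <->
  critical_local /\ psd_local.
Proof.
have [sQ sS sM sP] := hWL.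
apply: (best_responseP hL hx adm.1 sQ sS sP (c := fun v => cost sys pr N WL v uR)
  (r := \int[P]_t \sum_(0 <= k < N.+1) quad (wM WL) (uR k t))).
  exact: cost_local.
move=> v Uv; apply: cost_local => [|k kN|k kN|//].
- by apply/funext => k; apply/funext => t; rewrite state_perturb_local.
- by apply: vL2D; [exact: hx|exact: (vL2_vstate _ _ hL Uv)].
- by apply: vL2D; [exact: uLk|exact: (admissible_vL2 hL Uv kN)].
Qed.

Lemma best_response_remote :
  (forall v, UR v -> (cost sys pr N WR uL uR <= cost sys pr N WR uL v)%E) <->
  critical_remote /\ psd_remote.
Proof.
have [sQ sS sM sP] := hWR.
apply: (best_responseP hR hx adm.2 sQ sM sP (c := fun v => cost sys pr N WR uL v)
  (r := \int[P]_t \sum_(0 <= k < N.+1) quad (wS WR) (uL k t))).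
  exact: cost_remote.
move=> v Uv; apply: cost_remote => [|k kN|//|k kN].
- by apply/funext => k; apply/funext => t; rewrite state_perturb_remote.
- by apply: vL2D; [exact: hx|exact: (vL2_vstate _ _ hR Uv)].
- by apply: vL2D; [exact: uRk|exact: (admissible_vL2 hR Uv kN)].
Qed.

(** Both costates are conditioned on local information, so each player only needs an information set
    contained in it: the local set itself, or the remote one by [info_remote_local]. *)
Lemma stationary_pairP :
  stationary_pair sys pr N WL WR uL uR <-> critical_local /\ critical_remote.
Proof.
have PL := first_variation_eq0P (pA sys) (pBL sys) (wQ WL) (wS WL) (wP WL) hL hx adm.1.
have PR := first_variation_eq0P (pA sys) (pBR sys) (wQ WR) (wM WR) (wP WR) hR hx adm.2.
have sL k (kN : (k <= N)%N) := @subset_refl _ (info_local pr x k).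
have sR k (kN : (k <= N)%N) := @info_remote_local _ _ _ _ _ pr x k.
split=> [[_ [thL [thR [cL cR stL stR]]]]|[/PL gL /PR gR]].
  split.
    by apply/PL; exact: (stationary_grad hx hG sL adm.1 cL stL).
  by apply/PR; exact: (stationary_grad hx hG sR adm.2 cR stR).
have [thL [cL iL]] := costate_exists sys WL hx hG.
have [thR [cR iR]] := costate_exists sys WR hx hG.
split => //; exists thL, thR; split => //.
  exact: (grad_stationary hx hG sL adm.1 cL iL gL).
exact: (grad_stationary hx hG sR adm.2 cR iR gR).
Qed.

Lemma convexity_at :
  (0 <= ereal_inf [set second_variation_local P sys N WL du | du in UL])%E /\
  (0 <= ereal_inf [set second_variation_remote P sys N WR du | du in UR])%E <->
  psd_local /\ psd_remote.
Proof.
have EL := second_variation_infP P (pA sys) (pBL sys) (wQ WL) (wS WL) (wP WL) hL.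
have ER := second_variation_infP P (pA sys) (pBR sys) (wQ WR) (wM WR) (wP WR) hR.
by split=> -[/EL ? /ER ?].
Qed.

End at_pair.

Lemma nash_stationary uL uR : open_loop_nash sys pr N WL WR uL uR <->
  stationary_pair sys pr N WL WR uL uR /\ psd_local /\ psd_remote.
Proof.
split=> [[adm nL nR]|[st [cL cR]]].
  have [eL cL] := (best_response_local adm).1 nL.
  have [eR cR] := (best_response_remote adm).1 nR.
  by split=> //; apply/(stationary_pairP adm).
have adm := st.1; have [eL eR] := (stationary_pairP adm).1 st.
split => //; first by apply/(best_response_local adm).
by apply/(best_response_remote adm).
Qed.

End game.

Theorem theorem1 (d : measure_display) (T : measurableType d) (R : realType)
    (P : probability T R) (n m1 m2 N : nat) (sys : plant R n m1 m2)
    (WL WR : weights R n m1 m2) (pr : primitives P n)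
    (mu : 'cV[R]_n) (Sx0 Sw : 'M[R]_n) (p : R)
    (hWL : symmetric_weights WL) (hWR : symmetric_weights WR)
    (hp : 0 <= p <= 1)
    (hpr : standing_assumptions pr mu Sx0 Sw p) :
  exists_unique_pair P N (open_loop_nash sys pr N WL WR) <->
  (convexity_condition sys pr N WL WR /\
   exists_unique_pair P N (stationary_pair sys pr N WL WR)).
Proof.
have init2 : vL2 P (init pr) by case: hpr => /gaussian_vL2.
have noise2 k : vL2 P (noise pr k) by case: hpr => _ /(_ k)/gaussian_vL2.
have nash := nash_stationary N sys hWL hWR init2 noise2.
have conv := convexity_at WL WR init2 noise2.
split=> [[uL [uR [nu uniq]]]|[cvx [uL [uR [st uniq]]]]].
  have [st psd] := (nash uL uR).1 nu; split.
    (* Positivity, obtained at the Nash pair, mentions no pair and so gives convexity at every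
       admissible one. *)
    by move=> vL vR adm; exact: (conv _ _ _ _ adm).2.
  (* Given positivity, any other stationary pair is a Nash pair, to which uniqueness of the
     equilibrium applies. *)
  by exists uL, uR; split=> // vL vR sv; apply: uniq; apply/nash.
(* A stationary pair is admissible, so convexity can be evaluated there and yields the positivity
   that makes it a Nash pair. *)
have psd := (conv _ _ _ _ st.1).1 (cvx uL uR st.1).
exists uL, uR; split; first by apply/nash.
by move=> vL vR /nash[sv _]; exact: uniq.
Qed.
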